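(* Let $N\ge1$, let $\ell:\mathbb{R}^{d\times d'}\to\mathbb{R}$ be an analytic loss, and let $W(t)=W_N(t)\cdots W_1(t)$, $t\ge0$, be the product matrix of gradient flow with balanced initialization on the depth-$N$ factorization, with analytic singular value decomposition $W(t)=U(t)S(t)V^\top(t)$ (all as in the context). Assume that at initialization ($t=0$) the singular values of $W(t)$ are distinct and different from zero. Then the singular vectors of $W(t)$ evolve by $$\begin{aligned}\dot U(t) ={}& -U(t)\Big(F(t)\odot\big[U^\top(t)\nabla\ell(W(t))V(t)S(t)+S(t)V^\top(t)\nabla\ell^\top(W(t))U(t)\big]\Big)\\ &-\big(I_d-U(t)U^\top(t)\big)\nabla\ell(W(t))V(t)\,(S^2(t))^{\frac12-\frac1N},\end{aligned}$$ $$\begin{aligned}\dot V(t) ={}& -V(t)\Big(F(t)\odot\big[S(t)U^\top(t)\nabla\ell(W(t))V(t)+V^\top(t)\nabla\ell^\top(W(t))U(t)S(t)\big]\Big)\\ &-\big(I_{d'}-V(t)V^\top(t)\big)\nabla\ell^\top(W(t))U(t)\,(S^2(t))^{\frac12-\frac1N},\end{aligned}$$ where $I_d$ and $I_{d'}$ are the identity matrices of sizes $d\times d$ and $d'\times d'$, $\odot$ is the Hadamard (entrywise) product, and $F(t)\in\mathbb{R}^{\min\{d,d'\}\times\min\{d,d'\}}$ is the skew-symmetric matrix whose $(r,r')$ entry, $r\ne r'$, is $\big((\sigma_{r'}^2(t))^{1/N}-(\sigma_r^2(t))^{1/N}\big)^{-1}$. These equations are well-defined at every $t$ for which $\sigma_1^2(t),\dots,\sigma_{\min\{d,d'\}}^2(t)$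 are pairwise distinct and different from zero; any $t$ for which they are ill-defined is isolated, and the derivatives of $U$ and $V$ at such $t$ may be inferred by continuity. Moreover, the assumption on initialization can be relaxed: all that is needed is that no singular value be identically zero (for every $r$ there is $t$ with $\sigma_r(t)\neq0$) and that no pair of singular values be identical through time (for all $r\neq r'$ there is $t$ with $\sigma_r^2(t)\neq\sigma_{r'}^2(t)$).
   Context: Setting: $W_j\in\mathbb{R}^{d_j\times d_{j-1}}$ for $j=1,\dots,N$, with $d_N=d$, $d_0=d'$ and hidden dimensions $d_1,\dots,d_{N-1}\in\mathbb{N}$; $\phi(W_1,\dots,W_N):=\ell(W_NW_{N-1}\cdots W_1)$. Gradient flow: $\dot W_j(t) = -\frac{\partial}{\partial W_j}\phi(W_1(t),\dots,W_N(t))$ for $t\ge0$, $j=1,\dots,N$. Balanced initialization: $W_{j+1}^\top(0)W_{j+1}(0)=W_j(0)W_j^\top(0)$ for $j=1,\dots,N-1$. Analytic singular value decomposition: $W(t)=U(t)S(t)V^\top(t)$ where $U(t)\in\mathbb{R}^{d\times\min\{d,d'\}}$, $S(t)\in\mathbb{R}^{\min\{d,d'\}\times\min\{d,d'\}}$, $V(t)\in\mathbb{R}^{d'\times\min\{d,d'\}}$ are analytic functions of $t$, and for every $t$ the matrices $U(t),V(t)$ have orthonormal columns while $S(t)$ is diagonal (its diagonal entries may be negative and may appear in any order). Such a decomposition exists in this setting. The diagonal entries of $S(t)$ are the signed singular values $\sigma_1(t),\dots,\sigma_{\min\{d,d'\}}(t)$ of $W(t)$; the columns of $U(t)$ and $V(t)$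 are the corresponding left and right singular vectors. When $N\ge2$ the singular values need not be signed: one may assume $\sigma_r(t)\ge0$ for all $r$ and $t$. Here $\nabla\ell^\top(W)$ denotes the transpose of $\nabla\ell(W)$, and powers of the nonnegative diagonal matrix $S^2(t)$ are taken on its diagonal entries.
   Formalization: For N=1 with some negative signed singular value the stated factor (S^2)^{1/2-1/N}=|S|^{-1} gives the wrong sign; there the formal theorem proves the equations with S^{-1} instead, keeping the stated formula for N=1 when all singular values are nonnegative. *)

(* Defs.v *)
From HB Require Import structures.
From mathcomp Require Import all_boot all_order all_algebra.
From mathcomp Require Import all_classical all_reals all_analysis.

Set Implicit Arguments.
Unset Strict Implicit.
Unset Printing Implicit Defensive.

Import Order.TTheory GRing.Theory Num.Theory.
Import numFieldNormedType.Exports.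

Local Open Scope classical_set_scope.
Local Open Scope ring_scope.

Definition mxmonomial (R : realType) (m n : nat)
    (H : 'M[R]_(m, n)) (a : 'M[nat]_(m, n)) : R :=
  \prod_i \prod_j H i j ^+ a i j.

(* Real analyticity of a function of m * n real variables: around every A it
   is the sum of an absolutely convergent power series, with coefficients
   indexed by multi-indices.  By absolute convergence the order of summation is
   immaterial; partial sums are taken over the multi-indices whose components
   are all < k.  The norm of a matrix is the maximum of its entries in absolute
   value. *)
Definition mx_analytic (R : realType) (m n : nat)
    (f : 'M[R]_(m, n) -> R) : Prop :=
  forall A : 'M[R]_(m, n), exists (c : 'M[nat]_(m, n) -> R) (r : R),
    0 < r /\
    forall H : 'M[R]_(m, n), `|H| < r ->
      summable [set: 'M[nat]_(m, n)] (fun a => (c a * mxmonomial H a)%:E) /\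
      \sum_(a : 'M['I_k]_(m, n))
        c (map_mx (@nat_of_ord k) a) * mxmonomial H (map_mx (@nat_of_ord k) a)
        @[k --> \oo] --> f (A + H).

Definition mxgrad (R : realType) (m n : nat)
    (f : 'M[R]_(m, n) -> R) (A : 'M[R]_(m, n)) : 'M[R]_(m, n) :=
  \matrix_(i, j) ('D_(delta_mx i j) f A).

(* Functions of time t >= 0 are represented by functions on R whose values at
   negative times are never used: limits in time are taken within [0, +oo[, so
   that derivatives at t = 0 are one-sided. *)
Definition nonneg_dnbhs (R : realType) (t : R) : set_system R :=
  within [set s : R | 0 <= s] t^'.

Definition has_time_derivative (R : realType) (V : normedModType R)
    (f : R -> V) (t : R) (df : V) : Prop :=
  (s - t)^-1 *: (f s - f t) @[s --> nonneg_dnbhs t] --> df.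

Definition time_analytic (R : realType) (V : normedModType R)
    (f : R -> V) : Prop :=
  forall t : R, 0 <= t -> exists (c : nat -> V) (r : R),
    0 < r /\
    forall s : R, 0 <= s -> `|s - t| < r ->
      series (fun k => (s - t) ^+ k *: c k) @ \oo --> f s.

(* Depth-N factorizations.  Layers are numbered from 0: W j stands for the
   matrix W_{j+1}, of size d_{j+1} x d_j; only the layers j < N matter. *)
Definition layers (R : realType) (dims : nat -> nat) : Type :=
  forall j : nat, 'M[R]_(dims j.+1, dims j).

Fixpoint mxchain (R : realType) (dims : nat -> nat) (W : layers R dims)
    (N : nat) : 'M[R]_(dims N, dims 0%N) :=
  if N is k.+1 then W k *m mxchain W k else 1%:M.

Definition overparam_loss (R : realType) (dims : nat -> nat) (N : nat)
    (l : 'M[R]_(dims N, dims 0%N) -> R) (W : layers R dims) : R :=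
  l (mxchain W N).

Definition layer_grad (R : realType) (dims : nat -> nat) (N : nat)
    (l : 'M[R]_(dims N, dims 0%N) -> R) (W : layers R dims) (j : nat) :
    'M[R]_(dims j.+1, dims j) :=
  mxgrad (fun A : 'M[R]_(dims j.+1, dims j) =>
    overparam_loss l
      (@dfwith nat (fun i => 'M[R]_(dims i.+1, dims i)) W j A)) (W j).

Definition gradient_flow (R : realType) (dims : nat -> nat) (N : nat)
    (l : 'M[R]_(dims N, dims 0%N) -> R) (W : R -> layers R dims) : Prop :=
  forall (t : R) (j : nat), 0 <= t -> (j < N)%N ->
    has_time_derivative (fun s => W s j) t (- layer_grad l (W t) j).

Definition balanced (R : realType) (dims : nat -> nat) (N : nat)
    (W : layers R dims) : Prop :=
  forall j : nat, (j.+1 < N)%N -> (W j.+1)^T *m W j.+1 = W j *m (W j)^T.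

Definition analytic_svd (R : realType) (m n : nat) (M : R -> 'M[R]_(m, n))
    (U : R -> 'M[R]_(m, minn m n)) (S : R -> 'M[R]_(minn m n))
    (V : R -> 'M[R]_(n, minn m n)) : Prop :=
  [/\ time_analytic U, time_analytic S, time_analytic V &
      forall t : R, 0 <= t ->
        [/\ (U t)^T *m U t = 1%:M, (V t)^T *m V t = 1%:M,
            is_diag_mx (S t) & M t = U t *m S t *m (V t)^T]].

(* S `^ p, entrywise on the diagonal of S *)
Definition diag_powR (R : realType) (k : nat) (S : 'M[R]_k) (p : R) : 'M[R]_k :=
  diag_mx (\row_r (S r r `^ p)).

Definition hadamard (R : realType) (m n : nat) (A B : 'M[R]_(m, n)) :
    'M[R]_(m, n) :=
  map2_mx *%R A B.

Definition Fmx (R : realType) (k N : nat) (S : 'M[R]_k) : 'M[R]_k :=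
  \matrix_(r, r') if r == r' then 0 else
    ((S r' r' ^+ 2) `^ N%:R^-1 - (S r r ^+ 2) `^ N%:R^-1)^-1.

(* The expressions below use Rocq's total inverse and power; this says that the
   inverses occurring in Fmx are those of nonzero numbers and that
   (S^2)^(1/2 - 1/N) does not involve a negative power of zero. *)
Definition svd_flow_well_defined (R : realType) (k N : nat)
    (S : 'M[R]_k) : Prop :=
  (forall r r' : 'I_k, r != r' ->
     (S r' r' ^+ 2) `^ N%:R^-1 - (S r r ^+ 2) `^ N%:R^-1 != 0) /\
  (forall r : 'I_k, 0 <= 2^-1 - N%:R^-1 :> R \/ S r r ^+ 2 != 0).

(* G is the gradient of the loss and P is the factor (S^2)^(1/2 - 1/N). *)
Definition U_flow (R : realType) (m n k N : nat) (G : 'M[R]_(m, n))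
    (U : 'M[R]_(m, k)) (S : 'M[R]_k) (V : 'M[R]_(n, k)) (P : 'M[R]_k) :
    'M[R]_(m, k) :=
  - (U *m hadamard (Fmx N S) (U^T *m G *m V *m S + S *m V^T *m G^T *m U))
  - (1%:M - U *m U^T) *m G *m V *m P.

Definition V_flow (R : realType) (m n k N : nat) (G : 'M[R]_(m, n))
    (U : 'M[R]_(m, k)) (S : 'M[R]_k) (V : 'M[R]_(n, k)) (P : 'M[R]_k) :
    'M[R]_(n, k) :=
  - (V *m hadamard (Fmx N S) (S *m U^T *m G *m V + V^T *m G^T *m U *m S))
  - (1%:M - V *m V^T) *m G^T *m U *m P.

(* The evolution equations at the times where they are well-defined; at the
   other times the derivatives are the limits of the right-hand sides. *)
Definition singular_vectors_evolve (R : realType) (m n k N : nat)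
    (G : R -> 'M[R]_(m, n)) (U : R -> 'M[R]_(m, k)) (S : R -> 'M[R]_k)
    (V : R -> 'M[R]_(n, k)) (P : R -> 'M[R]_k) : Prop :=
  (forall t : R, 0 <= t -> svd_flow_well_defined N (S t) ->
     has_time_derivative U t (U_flow N (G t) (U t) (S t) (V t) (P t)) /\
     has_time_derivative V t (V_flow N (G t) (U t) (S t) (V t) (P t))) /\
  (forall t : R, 0 <= t -> ~ svd_flow_well_defined N (S t) ->
     exists (dU : 'M[R]_(m, k)) (dV : 'M[R]_(n, k)),
       [/\ has_time_derivative U t dU, has_time_derivative V t dV,
           U_flow N (G s) (U s) (S s) (V s) (P s)
             @[s --> nonneg_dnbhs t] --> dU &
           V_flow N (G s) (U s) (S s) (V s) (P s)
             @[s --> nonneg_dnbhs t] --> dV]).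

(* Main.v *)
Require Import Defs.
From HB Require Import structures.
From mathcomp Require Import all_boot all_order all_algebra.
From mathcomp Require Import all_classical all_reals all_analysis.
From mathcomp Require Import ring lra.

(* Balancedness is conserved, so with A = W_N W_N^T and B = W_1^T W_1 the
   product matrix satisfies W W^T = A^N, W^T W = B^N and
   W' = - sum_j A^(N-j) grad B^(j-1).  Positive semidefinite N-th roots are
   unique, hence A = U L U^T and B = V L V^T with L = (S^2)^(1/N).
   Differentiating W = U S V^T and projecting on the columns of U and V
   determines the skew-symmetric matrix U^T U' wherever the diagonal of L is
   simple, even if some singular value vanishes.  The component of U' orthogonal
   to the columns of U comes multiplied by S; where S is singular it is
   recovered by continuity, since U is C^1, l is C^1 and the bad times are
   isolated.  The equation for V is the one for U applied to W^T.  Both for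
   power series in time and for the loss, smoothness is obtained from the
   estimate |f x - f y - L (x - y)| <= C M |x - y| for x and y at distance at
   most M from the base point. *)

Set Implicit Arguments.
Unset Strict Implicit.
Unset Printing Implicit Defensive.

Import Order.TTheory GRing.Theory Num.Theory.
Import numFieldNormedType.Exports.

Local Open Scope classical_set_scope.
Local Open Scope ring_scope.

(** * Calculus on the half-line *)

(** Write K for U^T grad V, a for the diagonal of L and N = p + 1. Entries (r, s) and (s, r) of U^T
    W' V form a linear system in the entries of U^T U' and V'^T V, with determinant, up to sign,
    sigma_s^2 - sigma_r^2 = (a_s - a_r) c, where c = sum_j a_r^(p-j) a_s^j. The same c multiplies
    the entries of K on the right-hand side and cancels: this is the origin of the entries 1 / (a_s
    - a_r) of F. In the normal part, 1 - U U^T kills every positive power of A, so a single term of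
    the sum survives and (1 - U U^T) U' S = - (1 - U U^T) grad V L^p. The factor (S^2)^(1/2 - 1/N)
    is L^p S^-1 when S is positive; for N = 1 and signed S it must be S^-1 instead. The argument
    therefore runs with an abstract diagonal factor P, known through P S = L^p where S is nonzero
    and through continuity where S vanishes. Values at negative times are arbitrary, so derivatives
    are one-sided at 0 and the identity theorem is proved on the half-line by connectedness. *)

Section TimeLimits.
Context {R : realType}.

Lemma near_nonneg_dnbhsP (t : R) (P : set R) :
  (\forall s \near nonneg_dnbhs t, P s) <->
  exists2 d : R, 0 < d & forall s, 0 <= s -> `|s - t| < d -> s != t -> P s.
Proof.
rewrite /nonneg_dnbhs /dnbhs.
split.
  move=> /= /nbhs_ballP [d /= d0 H]; exists d => // s s0 sd st.
  by apply: (H s) => //; rewrite /ball /= distrC.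
move=> [d d0 H]; apply/nbhs_ballP; exists d => //= s.
rewrite /ball /= distrC => sd st s0; exact: H.
Qed.

Global Instance nonneg_dnbhs_filter (t : R) : Filter (nonneg_dnbhs t).
Proof. exact: within_filter. Qed.

Lemma nonneg_dnbhs_proper (t : R) : 0 <= t -> ProperFilter (nonneg_dnbhs t).
Proof.
move=> t0; apply: Build_ProperFilter_ex => P /near_nonneg_dnbhsP [d d0 H].
exists (t + d / 2); apply: H; first by lra.
  by rewrite addrC addKr gtr0_norm; lra.
by apply/eqP; lra.
Qed.

Lemma cvg_mxP (T : Type) (F : set_system T) {FF : Filter F} m n
    (f : T -> 'M[R]_(m, n)) (A : 'M[R]_(m, n)) :
  f @ F --> A <-> forall i j, f x i j @[x --> F] --> A i j.
Proof.
split=> [fA i j|H].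
  by apply: (@cvg_comp _ _ _ f (fun M => M i j)) fA _; exact: coord_continuous.
apply/cvgrPdist_lt => e e0.
have H2 : \forall x \near F, forall ij : 'I_m * 'I_n, `|A ij.1 ij.2 - f x ij.1 ij.2| < e.
  apply: filter_forall => -[i j] /=.
  by move/cvgrPdist_lt: (H i j); apply.
apply: filterS H2 => x Hx.
rewrite [ltLHS]mx_normrE; apply/bigmax_ltP; split=> // ij _.
by move: (Hx ij); rewrite !mxE.
Qed.

Definition time_deriv (f : R -> R) (t d : R) :=
  (s - t)^-1 * (f s - f t) @[s --> nonneg_dnbhs t] --> d.

Lemma has_time_derivative_mxP m n (f : R -> 'M[R]_(m, n)) t A :
  has_time_derivative f t A <-> forall i j, time_deriv (fun s => f s i j) t (A i j).
Proof.
have E i j : (fun s => ((s - t)^-1 *: (f s - f t)) i j) =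
    fun s => (s - t)^-1 * (f s i j - f t i j) by apply/funext => s; rewrite !mxE.
by rewrite /has_time_derivative cvg_mxP; split => H i j; move: (H i j); rewrite E.
Qed.

(** The increment form has no quotient, so it also covers s = t. This matters for the even extension
    below, whose argument may return to the base point. *)
Lemma time_deriv_bound (f : R -> R) t d : time_deriv f t d <->
  forall e, 0 < e -> exists2 del, 0 < del &
    forall s, 0 <= s -> `|s - t| < del -> `|f s - f t - d * (s - t)| <= e * `|s - t|.
Proof.
split=> [/cvgrPdist_le H e e0|H].
  have /near_nonneg_dnbhsP [del del0 Hd] := H e e0; exists del => // s s0 sd.
  have [->|st] := eqVneq s t; first by rewrite !subrr mulr0 subrr normr0 mulr0.
  have st0 : s - t != 0 by rewrite subr_eq0.
  have -> : f s - f t - d * (s - t) = ((s - t)^-1 * (f s - f t) - d) * (s - t).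
    by field.
  by rewrite normrM ler_wpM2r // distrC; exact: Hd.
apply/cvgrPdist_le => e e0; have [del del0 Hd] := H e e0.
apply/near_nonneg_dnbhsP; exists del => // s s0 sd st.
have st0 : s - t != 0 by rewrite subr_eq0.
have := Hd s s0 sd.
have -> : f s - f t - d * (s - t) = ((s - t)^-1 * (f s - f t) - d) * (s - t).
  by field.
by rewrite normrM ler_pM2r ?normr_gt0 // distrC.
Qed.

Lemma time_deriv_cvg f t d : time_deriv f t d ->
  f s @[s --> nonneg_dnbhs t] --> f t.
Proof.
move=> /time_deriv_bound /(_ 1 ltr01) [del del0 H].
apply/cvgrPdist_le => e e0; apply/near_nonneg_dnbhsP.
have d0 : 0 < 1 + `|d| by rewrite ltr_pwDl.
exists (Num.min del (e / (1 + `|d|))).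
  by rewrite lt_min del0 divr_gt0.
move=> s s0; rewrite lt_min => /andP[sd se] _.
have := H s s0 sd; rewrite mul1r => H1.
rewrite distrC -[f s - f t](subrK (d * (s - t))).
apply: le_trans (ler_normD _ _) _; rewrite normrM.
apply: le_trans (lerD H1 (lexx _)) _.
rewrite -{1}[`|s - t|]mul1r -mulrDl.
by move: (ltW se); rewrite ler_pdivlMr // mulrC.
Qed.

Lemma time_deriv_unique f t d d' : 0 <= t ->
  time_deriv f t d -> time_deriv f t d' -> d = d'.
Proof.
move=> t0 H H'; have FF := nonneg_dnbhs_proper t0.
exact: (cvg_unique _ H H').
Qed.

Lemma time_deriv_cst (a t : R) : time_deriv (fun=> a) t 0.
Proof.
rewrite /time_deriv; under eq_fun do rewrite subrr mulr0.
exact: cvg_cst.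
Qed.

Lemma time_derivD f g t df dg : time_deriv f t df -> time_deriv g t dg ->
  time_deriv (fun s => f s + g s) t (df + dg).
Proof.
move=> Hf Hg; rewrite /time_deriv.
under eq_fun => s.
  rewrite (_ : _ * _ = (s - t)^-1 * (f s - f t) + (s - t)^-1 * (g s - g t)); last by ring.
  over.
exact: cvgD.
Qed.

Lemma time_derivM f g t df dg : time_deriv f t df -> time_deriv g t dg ->
  time_deriv (fun s => f s * g s) t (df * g t + f t * dg).
Proof.
move=> Hf Hg; rewrite /time_deriv.
under eq_fun => s.
  rewrite (_ : _ * _ = (s - t)^-1 * (f s - f t) * g s + f t * ((s - t)^-1 * (g s - g t))); last by ring.
  over.
apply: cvgD; apply: cvgM => //; first exact: time_deriv_cvg Hg.
exact: cvg_cst.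
Qed.

Lemma time_deriv_sum (I : finType) (f : I -> R -> R) t (d : I -> R) :
  (forall i, time_deriv (f i) t (d i)) ->
  time_deriv (fun s => \sum_i f i s) t (\sum_i d i).
Proof.
move=> H.
suff : forall r : seq I, time_deriv (fun s => \sum_(i <- r) f i s) t (\sum_(i <- r) d i) by [].
elim=> [|i r IH].
  rewrite big_nil; under eq_fun do rewrite big_nil; exact: time_deriv_cst.
rewrite big_cons; under eq_fun do rewrite big_cons; exact: time_derivD.
Qed.

Lemma has_time_derivative_unique m n (f : R -> 'M[R]_(m, n)) t A B : 0 <= t ->
  has_time_derivative f t A -> has_time_derivative f t B -> A = B.
Proof.
move=> t0 /has_time_derivative_mxP HA /has_time_derivative_mxP HB.
by apply/matrixP => i j; apply: time_deriv_unique (HA i j) (HB i j).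
Qed.

Lemma has_time_derivative_mulmx m n p (f : R -> 'M[R]_(m, n))
    (g : R -> 'M[R]_(n, p)) t df dg :
  has_time_derivative f t df -> has_time_derivative g t dg ->
  has_time_derivative (fun s => f s *m g s) t (df *m g t + f t *m dg).
Proof.
move=> /has_time_derivative_mxP Hf /has_time_derivative_mxP Hg.
apply/has_time_derivative_mxP => i j; rewrite !mxE -big_split /=.
under eq_fun do rewrite mxE.
by apply: time_deriv_sum => k; apply: time_derivM.
Qed.

Lemma has_time_derivative_trmx m n (f : R -> 'M[R]_(m, n)) t df :
  has_time_derivative f t df -> has_time_derivative (fun s => (f s)^T) t df^T.
Proof.
move=> /has_time_derivative_mxP Hf; apply/has_time_derivative_mxP => i j.
by rewrite mxE; under eq_fun do rewrite mxE; exact: Hf.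
Qed.

Lemma has_time_derivative_cst m n (A : 'M[R]_(m, n)) t :
  has_time_derivative (fun=> A) t 0.
Proof.
by apply/has_time_derivative_mxP => i j; rewrite mxE; exact: time_deriv_cst.
Qed.

Lemma has_time_derivativeB m n (f g : R -> 'M[R]_(m, n)) t df dg :
  has_time_derivative f t df -> has_time_derivative g t dg ->
  has_time_derivative (fun s => f s - g s) t (df - dg).
Proof.
move=> Hf Hg; rewrite /has_time_derivative.
under eq_fun => s.
  rewrite (_ : _ *: _ = (s - t)^-1 *: (f s - f t) - (s - t)^-1 *: (g s - g t)).
    over.
  by rewrite -scalerBr !opprB [g t - _]addrC addrACA [- _ + g t]addrC.
exact: cvgB.
Qed.

(** Functions of time agree on [0, +oo[ only, so extensionality does not identify them. *)
Lemma eq_has_time_derivative m n (f g : R -> 'M[R]_(m, n)) t A : 0 <= t ->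
  (forall s, 0 <= s -> f s = g s) ->
  has_time_derivative f t A -> has_time_derivative g t A.
Proof.
move=> t0 fg; apply: cvg_trans; apply: near_eq_cvg; apply/near_nonneg_dnbhsP.
by exists 1 => // s s0 _ _; rewrite !fg.
Qed.

Lemma has_time_derivative_cvg m n (f : R -> 'M[R]_(m, n)) t A :
  has_time_derivative f t A -> f s @[s --> nonneg_dnbhs t] --> f t.
Proof.
move=> /has_time_derivative_mxP Hf; apply/cvg_mxP => i j.
exact: time_deriv_cvg (Hf i j).
Qed.

Lemma cvg_mulmx (T : Type) (F : set_system T) {FF : Filter F} m n p
    (f : T -> 'M[R]_(m, n)) (g : T -> 'M[R]_(n, p))
    (A : 'M[R]_(m, n)) (B : 'M[R]_(n, p)) :
  f @ F --> A -> g @ F --> B -> f x *m g x @[x --> F] --> A *m B.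
Proof.
move=> /cvg_mxP Hf /cvg_mxP Hg; apply/cvg_mxP => i j; rewrite mxE.
under eq_fun do rewrite mxE.
by apply: cvg_big => [|k _]; [exact: add_continuous | exact: cvgM].
Qed.

Lemma cvg_trmx (T : Type) (F : set_system T) {FF : Filter F} m n
    (f : T -> 'M[R]_(m, n)) (A : 'M[R]_(m, n)) :
  f @ F --> A -> (f x)^T @[x --> F] --> A^T.
Proof.
move=> /cvg_mxP Hf; apply/cvg_mxP => i j; rewrite mxE.
by under eq_fun do rewrite mxE; exact: Hf.
Qed.

(* The even extension [s |-> f |s|] is differentiable on the whole line. *)
Lemma time_deriv0_cst (f : R -> R) : (forall t, 0 <= t -> time_deriv f t 0) ->
  forall t, 0 <= t -> f t = f 0.
Proof.
move=> H t t0.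
suff D x : is_derive x (1 : R) (fun s => f `|s|) 0.
  by have := is_derive_0_is_cst t 0 D; rewrite ger0_norm // normr0.
suff C : h^-1 *: ((f `|h + x| : R^o) - f `|x|) @[h --> 0^'] --> (0 : R^o).
  have E : (fun h => h^-1 *: (((fun s => f `|s|) \o shift x) (h *: (1 : R)) - f `|x|))
    = fun h => h^-1 *: ((f `|h + x| : R^o) - f `|x|).
    by apply/funext => h /=; rewrite [h%:A]mulr1.
  split; first by rewrite /derivable E; apply/cvg_ex; exists 0.
  by rewrite /derive E; apply: cvg_lim.
apply/cvgrPdist_le => e e0.
have /time_deriv_bound /(_ e e0) [del del0 Hd] := H _ (normr_ge0 x).
near=> h.
have h0 : h != 0 by near: h; exact: nbhs_dnbhs_neq.
have hd : `|h| < del by near: h; exact: dnbhs0_lt.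
rewrite sub0r normrN [_ *: _]/(_ * _) normrM normfV mulrC ler_pdivrMr ?normr_gt0//.
(* The absolute value is 1-Lipschitz, so the increment of the extension is at most e |h|. Because
   the derivative is zero, the corner of |.| at 0 does no harm. *)
have nn : `| `|h + x| - `|x| | <= `|h|.
  by apply: le_trans (ler_dist_dist _ _) _; rewrite addrK.
have := Hd `|h + x| (normr_ge0 _) (le_lt_trans nn hd).
rewrite mul0r subr0 => /le_trans; apply.
by rewrite ler_pM2l.
Unshelve. all: by end_near. Qed.

Lemma has_time_derivative0_cst m n (f : R -> 'M[R]_(m, n)) :
  (forall t, 0 <= t -> has_time_derivative f t 0) ->
  forall t, 0 <= t -> f t = f 0.
Proof.
move=> H t t0; apply/matrixP => i j.
apply: (time_deriv0_cst (f := fun s => f s i j)) => // s s0.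
by have /has_time_derivative_mxP/(_ i j) := H s s0; rewrite mxE.
Qed.

End TimeLimits.

(** * Power series and the identity theorem *)

Section PowerSeries.
Context {R : realType}.

(** The usual bound n M^(n-1) |x - y| is multiplied by M, so that no truncated exponent n - 1
    appears. *)
Lemma normB_exprn (M x y : R) (n : nat) : `|x| <= M -> `|y| <= M ->
  M * `|x ^+ n - y ^+ n| <= n%:R * M ^+ n * `|x - y|.
Proof.
move=> xM yM; have M0 : 0 <= M by apply: le_trans xM.
elim: n => [|n IH]; first by rewrite !expr0 subrr normr0 mulr0 !mul0r.
have -> : x ^+ n.+1 - y ^+ n.+1 = x * (x ^+ n - y ^+ n) + (x - y) * y ^+ n.
  by rewrite !exprS; ring.
apply: le_trans (ler_wpM2l M0 (ler_normD _ _)) _.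
rewrite !normrM normrX mulrDr.
have H1 : M * (`|x| * `|x ^+ n - y ^+ n|) <= M * (n%:R * M ^+ n * `|x - y|).
  rewrite mulrCA; apply: le_trans (ler_wpM2l (normr_ge0 x) IH) _.
  by rewrite ler_wpM2r // !mulr_ge0 // exprn_ge0.
have H2 : M * (`|x - y| * `|y| ^+ n) <= M * (`|x - y| * M ^+ n).
  by rewrite !ler_wpM2l // lerXn2r // nnegrE.
apply: le_trans (lerD H1 H2) _.
by rewrite exprS -[n.+1]addn1 natrD le_eqVlt; apply/orP; left; apply/eqP; ring.
Qed.

(** Every factor M beyond the first two is at most rho / 4. With the index shifted by 2, one factor
    2^-n of 4^-n absorbs n + 2 <= 2 * 2^n and the other stays to make the terms summable; 8 is 2 *
    2^2. *)
Lemma mulrn_expr_le (M rho : R) (n : nat) : (2 <= n)%N -> 0 <= M -> 4 * M <= rho ->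
  n%:R * M ^+ n * rho ^+ 2 <= 8 * M ^+ 2 * (rho ^+ n * 2^-1 ^+ n).
Proof.
case: n => [|[|n]] // _ M0 Mr; have r0 : 0 <= rho by lra.
have n2 : (n.+2%:R : R) <= 2 * 2 ^+ n.
  elim: n => [|n IH]; first by rewrite expr0; lra.
  rewrite exprS -[n.+3]addn1 natrD.
  have : 1 <= (2 : R) ^+ n by rewrite exprn_ege1 //; lra.
  lra.
have Mn : M ^+ n <= (rho / 4) ^+ n by rewrite lerXn2r ?nnegrE; lra.
have -> : n.+2%:R * M ^+ n.+2 * rho ^+ 2 = (n.+2%:R * M ^+ n) * (M ^+ 2 * rho ^+ 2).
  by rewrite !exprS; ring.
have -> : 8 * M ^+ 2 * (rho ^+ n.+2 * 2^-1 ^+ n.+2) =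
    2 * 2 ^+ n * (rho / 4) ^+ n * (M ^+ 2 * rho ^+ 2).
  rewrite (_ : 2^-1 ^+ n.+2 = 2^-1 ^+ 2 * (2 ^+ n * 4^-1 ^+ n)).
    by rewrite exprMn !exprS expr0; field.
  rewrite -exprMn (_ : 2 * 4^-1 = 2^-1); last by field.
  by rewrite -exprD.
rewrite ler_wpM2r ?mulr_ge0 ?sqr_ge0 //.
by apply: ler_pM => //; exact: exprn_ge0.
Qed.

Lemma sum_half_le (m n : nat) : \sum_(m <= k < n) (2^-1 : R) ^+ k <= 2.
Proof.
have H p : \sum_(0 <= k < p) (2^-1 : R) ^+ k = 2 - 2 * 2^-1 ^+ p.
  elim: p => [|p IH]; first by rewrite big_nil expr0; ring.
  by rewrite big_nat_recr //= IH exprS; field.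
have [mn|nm] := leqP m n; last by rewrite big_geq ?(ltnW nm) //; lra.
apply: (@le_trans _ _ (\sum_(0 <= k < n) (2^-1 : R) ^+ k)).
  rewrite [leRHS](big_cat_nat (leq0n m) mn) //= lerDr sumr_ge0 //.
rewrite H; have : 0 <= (2^-1 : R) ^+ n by rewrite exprn_ge0.
lra.
Qed.

(** The terms of a convergent series tend to zero, hence are bounded. *)
Lemma power_series_coef_bound (c : nat -> R) (x l : R) :
  series (fun k => x ^+ k * c k) @ \oo --> l ->
  exists2 K : R, 0 <= K & forall k, `|c k| * `|x| ^+ k <= K.
Proof.
move=> H; have : (fun k => x ^+ k * c k) @ \oo --> (0 : R^o).
  by apply: cvg_series_cvg_0; apply/cvg_ex; exists l.
move=> /cvgP /cvg_seq_bounded/pinfty_ex_gt0[K K0 /= uK].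
exists K => [|k]; first exact: ltW.
by rewrite -normrX -normrM mulrC; exact: uK.
Qed.

(** Constant terms cancel in f s - f s' and the linear one is subtracted; each remaining term
    carries a factor M |s - s'| and decays geometrically. Letting both points move is what later
    controls the derivative near t, not only at t. *)
Lemma power_series_strict (c : nat -> R) (r t : R) (f : R -> R) :
  0 < r -> 0 <= t ->
  (forall s, 0 <= s -> `|s - t| < r ->
    series (fun k => (s - t) ^+ k * c k) @ \oo --> f s) ->
  exists C del : R, [/\ 0 <= C, 0 < del &
    forall s s' M : R, 0 <= s -> 0 <= s' -> 0 < M -> M <= del ->
      `|s - t| <= M -> `|s' - t| <= M ->
      `|f s - f s' - c 1%N * (s - s')| <= C * M * `|s - s'|].
Proof.
move=> r0 t0 H.
(* The point t + rho is within the radius and to the right of t, hence a nonnegative time: the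
   expansion can be evaluated there to bound the coefficients. *)
pose rho := r / 2; have rho0 : 0 < rho by rewrite /rho; lra.
have Ht : series (fun k => (t + rho - t) ^+ k * c k) @ \oo --> f (t + rho).
  apply: H; first by lra.
  by rewrite addrAC subrr add0r gtr0_norm // /rho; lra.
have [K K0 cK] := power_series_coef_bound Ht.
have {}cK k : `|c k| * rho ^+ k <= K.
  by have := cK k; rewrite addrAC subrr add0r (gtr0_norm rho0).
(* 16 is the 8 of [mulrn_expr_le] times the bound 2 of [sum_half_le]. *)
pose C := 16 * K / rho ^+ 2.
have C0 : 0 <= C by rewrite /C divr_ge0 ?sqr_ge0 //; lra.
exists C, (rho / 4); split; [by []|lra|].
move=> s s' M s0 s'0 M0 Mr sM s'M.
have sr : `|s - t| < r by apply: le_lt_trans sM _; rewrite /rho in Mr *; lra.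
have s'r : `|s' - t| < r by apply: le_lt_trans s'M _; rewrite /rho in Mr *; lra.
pose g n := series (fun k => (s - t) ^+ k * c k) n
  - series (fun k => (s' - t) ^+ k * c k) n - c 1%N * (s - s').
have gl : g @ \oo --> f s - f s' - c 1%N * (s - s').
  by apply: cvgB; [apply: cvgB; exact: H|exact: cvg_cst].
have ngl : `|g n| @[n --> \oo] --> `|f s - f s' - c 1%N * (s - s')|.
  exact: cvg_norm.
apply: (@ler_cvg_to _ _ _ _ _ (cst (C * M * `|s - s'|)) _ _ ngl).
  exact: cvg_cst.
exists 2%N => // n /= n2.
have -> : g n = \sum_(2 <= k < n) c k * ((s - t) ^+ k - (s' - t) ^+ k).
  rewrite /g /series /= -sumrB.
  have -> : \sum_(0 <= i < n) ((s - t) ^+ i * c i - (s' - t) ^+ i * c i) =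
      \sum_(0 <= k < n) c k * ((s - t) ^+ k - (s' - t) ^+ k).
    by apply: eq_bigr => k _; ring.
  rewrite (big_ltn (ltnW n2)) (big_ltn n2) !expr0 !expr1; ring.
have T k : (2 <= k)%N -> `|c k * ((s - t) ^+ k - (s' - t) ^+ k)| <=
    8 * K / rho ^+ 2 * M * `|s - s'| * 2^-1 ^+ k.
  move=> k2; have B1 := normB_exprn k sM s'M.
  have B2 := @mulrn_expr_le M rho k k2 (ltW M0) ltac:(lra).
  have r2 : 0 < rho ^+ 2 by rewrite exprn_gt0.
  (* [B1] carries a factor M and [B2] a factor rho^2; the goal is multiplied by both. *)
  rewrite normrM -(ler_pM2r (mulr_gt0 M0 r2)).
  have -> : s - s' = s - t - (s' - t) by ring.
  set D := `|s - t - (s' - t)| in B1 *.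
  have D0 : 0 <= D by exact: normr_ge0.
  set E := `|_ ^+ k - _| in B1 *.
  have -> : `|c k| * E * (M * rho ^+ 2) = `|c k| * (M * E) * rho ^+ 2 by ring.
  apply: (@le_trans _ _ (`|c k| * (k%:R * M ^+ k * D) * rho ^+ 2)).
    by apply: ler_wpM2r; [exact: ltW|exact: ler_wpM2l].
  have -> : `|c k| * (k%:R * M ^+ k * D) * rho ^+ 2 =
    `|c k| * D * (k%:R * M ^+ k * rho ^+ 2) by ring.
  apply: (@le_trans _ _ (`|c k| * D * (8 * M ^+ 2 * (rho ^+ k * 2^-1 ^+ k)))).
    by apply: ler_wpM2l => //; apply: mulr_ge0.
  have -> : `|c k| * D * (8 * M ^+ 2 * (rho ^+ k * 2^-1 ^+ k)) =
     (`|c k| * rho ^+ k) * (8 * M ^+ 2 * D * 2^-1 ^+ k) by ring.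
  have -> : 8 * K / rho ^+ 2 * M * D * 2^-1 ^+ k * (M * rho ^+ 2) =
     K * (8 * M ^+ 2 * D * 2^-1 ^+ k) by field; lra.
  by rewrite ler_wpM2r // !mulr_ge0 ?sqr_ge0 ?exprn_ge0 // ltW.
apply: (le_trans (ler_norm_sum _ _ _)).
apply: (@le_trans _ _ (\sum_(2 <= k < n) 8 * K / rho ^+ 2 * M * `|s - s'| * 2^-1 ^+ k)).
  by rewrite big_nat [leRHS]big_nat; apply: ler_sum => k /andP[k2 _]; exact: T.
rewrite -mulr_sumr; have := sum_half_le 2 n.
set Q := _ * M * _ => hs; have Q0 : 0 <= Q.
  by rewrite /Q !mulr_ge0 // ?invr_ge0 ?sqr_ge0 // ltW.
apply: le_trans (ler_wpM2l Q0 hs) _.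
by rewrite /Q /C le_eqVlt; apply/orP; left; apply/eqP; ring.
Qed.

End PowerSeries.

(** * Derivatives and zeros of analytic functions of time *)

Section Analytic.
Context {R : realType}.

Definition real_analytic (f : R -> R) : Prop :=
  forall t : R, 0 <= t -> exists (c : nat -> R) (r : R),
    0 < r /\
    forall s : R, 0 <= s -> `|s - t| < r ->
      series (fun k => (s - t) ^+ k * c k) @ \oo --> f s.

Lemma real_analyticD f g :
  real_analytic f -> real_analytic g -> real_analytic (fun t => f t + g t).
Proof.
move=> Hf Hg t t0; have [c [r [r0 H]]] := Hf t t0.
have [c' [r' [r0' H']]] := Hg t t0.
exists (fun k => c k + c' k), (Num.min r r'); split; first by rewrite lt_min r0.
move=> s s0; rewrite lt_min => /andP[sr sr'].
have -> : series (fun k => (s - t) ^+ k * (c k + c' k)) =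
    series (fun k => (s - t) ^+ k * c k) \+ series (fun k => (s - t) ^+ k * c' k).
  apply/funext => n; rewrite /series /= -big_split /=.
  by apply: eq_bigr => k _; rewrite mulrDr.
by apply: cvgD; [exact: H|exact: H'].
Qed.

Lemma real_analyticN f : real_analytic f -> real_analytic (fun t => - f t).
Proof.
move=> Hf t t0; have [c [r [r0 H]]] := Hf t t0.
exists (fun k => - c k), r; split=> // s s0 sr.
have -> : series (fun k => (s - t) ^+ k * - c k) =
    (fun n => - series (fun k => (s - t) ^+ k * c k) n).
  apply/funext => n; rewrite /series /= -sumrN.
  by apply: eq_bigr => k _; rewrite mulrN.
by apply: cvgN; exact: H.
Qed.

Lemma time_analytic_entry m n (f : R -> 'M[R]_(m, n)) i j :
  time_analytic f -> real_analytic (fun t => f t i j).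
Proof.
move=> Hf t t0; have [c [r [r0 H]]] := Hf t t0.
exists (fun k => c k i j), r; split=> // s s0 sr.
have /cvg_mxP /(_ i j) := H s s0 sr.
rewrite (_ : (fun n => _) = series (fun k => (s - t) ^+ k * c k i j)) //.
apply/funext => k.
by rewrite /series /= summxE; apply: eq_bigr => l _; rewrite mxE.
Qed.

(** For the second part, apply the estimate to the pair (u, s) and let u tend to s: any derivative
    at a point near t is within C M of the one at t. *)
Lemma strict_time_deriv (f : R -> R) (t a C del : R) : 0 <= t -> 0 <= C -> 0 < del ->
  (forall s s' M : R, 0 <= s -> 0 <= s' -> 0 < M -> M <= del ->
      `|s - t| <= M -> `|s' - t| <= M ->
      `|f s - f s' - a * (s - s')| <= C * M * `|s - s'|) ->
  time_deriv f t a /\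
  forall s d M : R, 0 <= s -> `|s - t| < M -> M <= del ->
    time_deriv f s d -> `|d - a| <= C * M.
Proof.
move=> t0 C0 del0 H; split.
  apply/time_deriv_bound => e e0.
  have C1 : 0 < C + 1 by lra.
  exists (Num.min del (e / (C + 1))); first by rewrite lt_min del0 divr_gt0.
  move=> s s0; rewrite lt_min => /andP[sd se].
  have [->|st] := eqVneq s t; first by rewrite !subrr mulr0 subrr normr0 mulr0.
  have st0 : 0 < `|s - t| by rewrite normr_gt0 subr_eq0.
  apply: le_trans (H s t `|s - t| s0 t0 st0 (ltW sd) (lexx _) _) _.
    by rewrite subrr normr0.
  rewrite ler_pM2r //; move: se; rewrite ltr_pdivlMr // => /ltW; apply: le_trans.
  by rewrite mulrC ler_pM2l //; lra.
move=> s d M s0 sM Mdel Hd; have FF := nonneg_dnbhs_proper s0.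
have M0 : 0 < M by apply: le_lt_trans sM.
have lim : `|(u - s)^-1 * (f u - f s) - a| @[u --> nonneg_dnbhs s] --> `|d - a|.
  by apply: cvg_norm; apply: cvgB => //; exact: cvg_cst.
apply: (@ler_cvg_to _ _ _ _ _ (cst (C * M)) _ _ lim); first exact: cvg_cst.
(* The strict inequality on s leaves this room around it: every such u is still within M of t. *)
apply/near_nonneg_dnbhsP; exists (M - `|s - t|); first by lra.
move=> u u0 us une.
have us0 : u - s != 0 by rewrite subr_eq0.
have -> : (u - s)^-1 * (f u - f s) - a = (u - s)^-1 * (f u - f s - a * (u - s)).
  by field.
rewrite normrM normfV mulrC ler_pdivrMr ?normr_gt0 //.
apply: H => //; last exact: ltW.
have -> : u - t = (u - s) + (s - t) by ring.
by apply: le_trans (ler_normD _ _) _; lra.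
Qed.

Lemma real_analytic_deriv (f : R -> R) : real_analytic f ->
  exists df : R -> R, forall t, 0 <= t ->
    time_deriv f t (df t) /\ df s @[s --> nonneg_dnbhs t] --> df t.
Proof.
move=> Hf.
have K t : 0 <= t -> exists a C del, [/\ 0 <= C, 0 < del, time_deriv f t a &
  forall s d M : R, 0 <= s -> `|s - t| < M -> M <= del ->
    time_deriv f s d -> `|d - a| <= C * M].
  move=> t0; have [c [r [r0 H]]] := Hf t t0.
  have [C [del [C0 del0 B]]] := power_series_strict r0 t0 H.
  have [H1 H2] := strict_time_deriv t0 C0 del0 B.
  by exists (c 1%N), C, del.
have /choice [df Hdf] : forall t, exists a, 0 <= t -> time_deriv f t a.
  move=> t; have [t0|t0] := pselect (0 <= t); last by exists 0.
  by have [a [_ [_ [_ _ H _]]]] := K t t0; exists a.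
exists df => t t0; split; first exact: Hdf.
have [a [C [del [C0 del0 Ha B]]]] := K t t0.
rewrite (time_deriv_unique t0 (Hdf t t0) Ha).
apply/cvgrPdist_le => e e0; apply/near_nonneg_dnbhsP.
have C1 : 0 < 2 * C + 1 by lra.
exists (Num.min (del / 2) (e / (2 * C + 1))).
  by rewrite lt_min !divr_gt0.
move=> s s0; rewrite lt_min => /andP[sd se] st.
have st0 : 0 < `|s - t| by rewrite normr_gt0 subr_eq0.
rewrite distrC.
(* The scale must strictly exceed |s - t|; taking twice that distance accounts for del / 2 and 2 C +
   1 above. *)
apply: le_trans (B s (df s) (2 * `|s - t|) s0 _ _ (Hdf s s0)) _; [lra|lra|].
move: se; rewrite ltr_pdivlMr // => /ltW; apply: le_trans.
rewrite mulrA [leRHS]mulrC ler_pM2r //; lra.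
Qed.

Lemma time_analytic_deriv m n (f : R -> 'M[R]_(m, n)) : time_analytic f ->
  exists df : R -> 'M[R]_(m, n), forall t, 0 <= t ->
    has_time_derivative f t (df t) /\ df s @[s --> nonneg_dnbhs t] --> df t.
Proof.
move=> Hf.
have /choice [g Hg] : forall ij : 'I_m * 'I_n, exists df : R -> R,
  forall t, 0 <= t -> time_deriv (fun s => f s ij.1 ij.2) t (df t) /\
    df s @[s --> nonneg_dnbhs t] --> df t.
  by move=> ij; apply: real_analytic_deriv; exact: time_analytic_entry.
exists (fun t => \matrix_(i, j) g (i, j) t) => t t0; split.
  apply/has_time_derivative_mxP => i j; rewrite mxE.
  by have [] := Hg (i, j) t t0.
apply/cvg_mxP => i j; rewrite mxE; under eq_fun do rewrite mxE.
by have [] := Hg (i, j) t t0.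
Qed.

(* Dividing by the first power that occurs reduces to a series with nonzero
   constant term. *)
Lemma real_analytic_local_zero (f : R -> R) (t : R) : real_analytic f -> 0 <= t ->
  (exists2 d : R, 0 < d & forall s, 0 <= s -> `|s - t| < d -> f s = 0) \/
  (exists2 d : R, 0 < d & forall s, 0 <= s -> `|s - t| < d -> s != t -> f s != 0).
Proof.
move=> Hf t0; have [c [r [r0 H]]] := Hf t t0.
have [c0|/existsNP] := pselect (forall k, c k = 0).
  left; exists r => // s s0 sr.
  have E : series (fun k => (s - t) ^+ k * c k) = cst 0.
    by apply/funext => n; rewrite /series /= big1 // => k _; rewrite c0 mulr0.
  have := H s s0 sr; rewrite E => H0.
  have H1 : (cst 0 : nat -> R) @ \oo --> (0 : R) by exact: cvg_cst.
  exact: (cvg_unique _ H0 H1).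
move=> [k0 /eqP ck0]; right.
have ex : exists k, c k != 0 by exists k0.
pose m := ex_minn ex.
have [cm low] : c m != 0 /\ forall k, (k < m)%N -> c k = 0.
  rewrite /m; case: ex_minnP => p cp lowp; split=> // k kp.
  by apply/eqP; apply: contraTT kp => ck; rewrite -leqNgt; exact: lowp.
(* At t the quotient is given its limit, so that the shifted series represents it on the whole
   neighbourhood. *)
pose g (s : R) := if s == t then c m else f s / (s - t) ^+ m.
have Hg s : 0 <= s -> `|s - t| < r ->
    series (fun k => (s - t) ^+ k * c (k + m)%N) @ \oo --> g s.
  move=> s0 sr; rewrite /g; case: eqVneq => [->|st].
    rewrite -cvg_shiftS.
    suff -> : [sequence series (fun k => (t - t) ^+ k * c (k + m)%N) n.+1]_n = cst (c m).
      exact: cvg_cst.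
    apply/funext => n; rewrite /series /= big_nat_recl //= expr0 mul1r add0n.
    by rewrite big1 ?addr0 // => k _; rewrite subrr expr0n mul0r.
  have st0 : (s - t) ^+ m != 0 by rewrite expf_neq0 // subr_eq0.
  have -> : series (fun k => (s - t) ^+ k * c (k + m)%N) =
      [sequence series (fun k => (s - t) ^+ k * c k) (n + m)%N / (s - t) ^+ m]_n.
    apply/funext => n; rewrite /series /= (big_cat_nat (leq0n m) (leq_addl n m)) /=.
    rewrite [X in (X + _) / _]big_nat_cond [X in (X + _) / _]big1 ?add0r; last first.
      by move=> k /andP[/andP[_ km] _]; rewrite low ?mulr0.
    have -> : \sum_(m <= k < n + m) (s - t) ^+ k * c k =
        \sum_(0 <= k < n) (s - t) ^+ (k + m) * c (k + m)%N.
      by rewrite -{1}[m]add0n big_addn addnK.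
    rewrite mulr_suml; apply: eq_bigr => k _.
    by rewrite exprD; field.
  apply: cvgM; last exact: cvg_cst.
  rewrite (cvg_shiftn m (series (fun k => (s - t) ^+ k * c k)) (nbhs (f s))).
  exact: H.
have [C [del [C0 del0 B]]] := power_series_strict r0 t0 Hg.
(* If g vanishes at s, comparing s with t at scale del gives |c m| <= (C del + |c (1 + m)|) |s - t|,
   impossible for |s - t| < |c m| / L. The added 1 keeps L positive. *)
pose L := C * del + `|c (1 + m)%N| + 1.
have L0 : 0 < L by rewrite /L ltr_wpDl // addr_ge0 // mulr_ge0 // ltW.
have cm0 : 0 < `|c m| by rewrite normr_gt0.
exists (Num.min del (`|c m| / L)); first by rewrite lt_min del0 divr_gt0.
move=> s s0; rewrite lt_min => /andP[sdel sL] st.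
have := B s t del s0 t0 del0 (lexx _) (ltW sdel).
rewrite subrr normr0 => /(_ (ltW del0)) B1.
suff : g s != 0.
  by rewrite /g (negbTE st); apply: contraNN => /eqP ->; rewrite mul0r.
apply/negP => /eqP gs; move: B1; rewrite gs {1}/g eqxx sub0r => B1.
have : `|c m| <= C * del * `|s - t| + `|c (1 + m)%N| * `|s - t|.
  rewrite -normrN -[- c m](subrK (c (1 + m)%N * (s - t))).
  by apply: le_trans (ler_normD _ _) _; rewrite normrM lerD2r.
rewrite -mulrDl => H1.
move: sL; rewrite ltr_pdivlMr // => H2.
have : `|s - t| * L < (C * del + `|c (1 + m)%N|) * `|s - t|.
  exact: lt_le_trans H1.
rewrite mulrC /L mulrDl gtrDl mul1r => H3.
by have := normr_ge0 (s - t); rewrite leNgt H3.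
Qed.

(** By the local dichotomy the open sets [Z] (f vanishes near u) and [NZ] (u is at most an isolated
    zero) cover [0, +oo[ and are disjoint on it. A point in [Z] would put the whole connected
    half-line in [Z], against the existence of a nonzero value. *)
Lemma real_analytic_isolated_zeros (f : R -> R) : real_analytic f ->
  (exists2 t, 0 <= t & f t != 0) ->
  forall t, 0 <= t -> \forall s \near nonneg_dnbhs t, f s != 0.
Proof.
move=> Hf [a a0 fa] t t0.
pose Z := [set u : R | exists2 d : R, 0 < d &
  forall s, 0 <= s -> `|s - u| < d -> f s = 0].
pose NZ := [set u : R | exists2 d : R, 0 < d &
  forall s, 0 <= s -> `|s - u| < d -> s != u -> f s != 0].
have oZ : open Z.
  rewrite openE => u [d d0 H]; apply/nbhs_ballP; exists (d / 2) => /=; first by lra.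
  move=> v; rewrite /ball /= => uv; exists (d / 2); first by lra.
  move=> s s0 sv; apply: H => //.
  have -> : s - u = (s - v) - (u - v) by ring.
  by apply: le_lt_trans (ler_normB _ _) _; lra.
have oNZ : open NZ.
  rewrite openE => u [d d0 H]; apply/nbhs_ballP; exists d => //= v.
  rewrite /ball /= => uv; have [<-|vu] := eqVneq u v; first by exists d.
  (* The second radius keeps u itself, the only possible zero, out of reach. *)
  exists (Num.min (d - `|u - v|) `|u - v|).
    by rewrite lt_min normr_gt0 subr_eq0 vu andbT; lra.
  move=> s s0; rewrite lt_min => /andP[s1 s2] sv; apply: H => //.
    have -> : s - u = (s - v) - (u - v) by ring.
    by apply: le_lt_trans (ler_normB _ _) _; lra.
  by apply/eqP => su; move: s2; rewrite su ltxx.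
have ZN u : 0 <= u -> Z u -> ~ NZ u.
  move=> u0 [d d0 H] [d' d'0 H'].
  (* u + e is a nonnegative time other than u and within both radii. *)
  pose e := Num.min d d' / 2.
  have m0 : 0 < Num.min d d' by rewrite lt_min d0.
  have eu : `|u + e - u| < Num.min d d'.
    by rewrite addrAC subrr add0r gtr0_norm /e; lra.
  move: eu; rewrite lt_min => /andP[e1 e2].
  have e0 : 0 < e by rewrite /e; lra.
  have ue0 : 0 <= u + e by lra.
  have := H' _ ue0 e2; rewrite (H _ ue0 e1) eqxx => /(_ _).
  by case/(_ _)/negP => //; apply/eqP; lra.
have [tZ|] := real_analytic_local_zero Hf t0; last by move=> H; exact/near_nonneg_dnbhsP.
pose A := [set u : R | 0 <= u].
have cA : connected A.
  apply/connected_intervalP => x y /= x0 y0 z /andP[xz _]; exact: le_trans xz.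
have : A `&` Z = A.
  apply: cA; first by exists t.
    by exists Z.
  exists (~` NZ); first exact: open_closedC.
  apply/seteqP; split=> u [Au Hu]; split=> //; first exact: ZN.
  by have [|] := real_analytic_local_zero Hf Au.
move=> /seteqP[_ /(_ a a0)] [_ [d d0 /(_ a a0)]].
by rewrite subrr normr0 => /(_ d0) /eqP; rewrite (negbTE fa).
Qed.

End Analytic.

(** * Analytic functions of a matrix *)

Section MatrixAnalytic.
Context {R : realType}.

Lemma norm_prod_expr_le (I : Type) (r : seq I) (M : R) (x : I -> R) (e : I -> nat) :
  (forall i, `|x i| <= M) ->
  `|\prod_(i <- r) x i ^+ e i| <= M ^+ (\sum_(i <- r) e i).
Proof.
move=> xM; elim: r => [|i r IH]; first by rewrite !big_nil expr0 normr1.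
rewrite !big_cons exprD normrM normrX; apply: ler_pM => //.
rewrite lerXn2r ?nnegrE //; exact: le_trans (xM i).
Qed.

(** The factors of the product are exchanged one at a time; the total degree replaces the exponent
    of [normB_exprn], with the same extra factor M. *)
Lemma normB_prod_expr_le (I : Type) (r : seq I) (M D : R) (x y : I -> R)
    (e : I -> nat) :
  0 <= M -> (forall i, `|x i| <= M) -> (forall i, `|y i| <= M) ->
  (forall i, `|x i - y i| <= D) ->
  M * `|\prod_(i <- r) x i ^+ e i - \prod_(i <- r) y i ^+ e i| <=
    (\sum_(i <- r) e i)%:R * M ^+ (\sum_(i <- r) e i) * D.
Proof.
move=> M0 xM yM xyD; elim: r => [|i r IH].
  by rewrite !big_nil subrr normr0 mulr0 !mul0r.
rewrite !big_cons.
have := norm_prod_expr_le r e yM.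
move: IH.
set X := \prod_(j <- r) x j ^+ e j; set Y := \prod_(j <- r) y j ^+ e j.
set d := (\sum_(j <- r) e j)%N => IH YM.
have -> : x i ^+ e i * X - y i ^+ e i * Y =
  x i ^+ e i * (X - Y) + (x i ^+ e i - y i ^+ e i) * Y by ring.
apply: le_trans (ler_wpM2l M0 (ler_normD _ _)) _.
rewrite mulrDr !normrM normrX.
have H1 : M * (`|x i| ^+ e i * `|X - Y|) <= M ^+ e i * (d%:R * M ^+ d * D).
  rewrite mulrCA; apply: ler_pM => //; first exact: mulr_ge0.
  rewrite lerXn2r ?nnegrE //; exact: le_trans (xM i).
have H2 : M * (`|x i ^+ e i - y i ^+ e i| * `|Y|) <= ((e i)%:R * M ^+ e i * D) * M ^+ d.
  rewrite mulrA; apply: ler_pM => //; first exact: mulr_ge0.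
  apply: le_trans (normB_exprn (e i) (xM i) (yM i)) _.
  by apply: ler_wpM2l => //; rewrite mulr_ge0 // exprn_ge0.
apply: le_trans (lerD H1 H2) _.
by rewrite natrD exprD le_eqVlt; apply/orP; left; apply/eqP; ring.
Qed.

(** The bound is uniform in the finite family; it serves for the multi-indices with entries below k,
    for all k at once. *)
Lemma summable_sum_bound (T : choiceType) (F : T -> R) :
  summable [set: T] (EFin \o F) ->
  exists K : R, forall (I : finType) (g : I -> T), injective g ->
    \sum_i `|F (g i)| <= K.
Proof.
move=> sF; exists (fine (\esum_(x in [set: T]) `|(F x)%:E|)%E) => I g gi.
have fin : (\esum_(x in [set: T]) `|(F x)%:E|)%E \is a fin_num.
  by rewrite -(@summableE _ _ _ (EFin \o F)).
rewrite -lee_fin fineK //; apply: esum_ge.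
have ur : uniq [seq g i | i <- index_enum I].
  by rewrite map_inj_uniq // index_enum_uniq.
exists [set` [seq g i | i <- index_enum I]]; first by split.
by rewrite -fsbig_seq // big_map -sumEFin.
Qed.

Definition mxdeg m n (a : 'M[nat]_(m, n)) : nat := (\sum_ij a ij.1 ij.2)%N.

Lemma mxmonomialE m n (H : 'M[R]_(m, n)) (a : 'M[nat]_(m, n)) :
  mxmonomial H a = \prod_ij H ij.1 ij.2 ^+ a ij.1 ij.2.
Proof. by rewrite /mxmonomial pair_bigA. Qed.

Lemma mx_normr_entry m n (A : 'M[R]_(m, n)) i j : `|A i j| <= `|A|.
Proof.
rewrite [leRHS]mx_normrE.
exact: (@le_bigmax _ _ _ _ (fun ij : 'I_m * 'I_n => `|A ij.1 ij.2|) (i, j)).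
Qed.

Lemma mx_normr_le m n (A : 'M[R]_(m, n)) (M : R) : 0 <= M ->
  (forall i j, `|A i j| <= M) -> `|A| <= M.
Proof.
move=> M0 H; rewrite [leLHS]mx_normrE.
by apply/bigmax_leP; split=> // ij _; exact: H.
Qed.

Definition mxunit m n (i : 'I_m) (j : 'I_n) : 'M[nat]_(m, n) :=
  \matrix_(p, q) ((p == i) && (q == j) : nat).

Lemma mxdeg1P m n (a : 'M[nat]_(m, n)) i j : mxdeg a = 1%N -> a i j != 0%N ->
  a = mxunit i j.
Proof.
move=> da aij; apply/matrixP => p q; rewrite mxE.
have H : mxdeg a = (a i j + \sum_(ij | ij != (i, j)) a ij.1 ij.2)%N.
  by rewrite /mxdeg (bigD1 (i, j)).
case: eqVneq => [->|pi] /=; last first.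
  have pq : (p, q) != (i, j) by rewrite xpair_eqE (negbTE pi).
  move: H; rewrite (bigD1 (p, q)) //= da.
  by case: (a i j) aij => // x _; case: (a p q) => // y; rewrite addnS addSn.
case: eqVneq => [->|qj] /=.
  by move: H; rewrite da; case: (a i j) aij => // -[|x].
have pq : (i, q) != (i, j) by rewrite xpair_eqE (negbTE qj) andbF.
move: H; rewrite (bigD1 (i, q)) //= da.
by case: (a i j) aij => // x _; case: (a i q) => // y; rewrite addnS addSn.
Qed.

Lemma mxdeg_unit m n (i : 'I_m) (j : 'I_n) : mxdeg (mxunit i j) = 1%N.
Proof.
rewrite /mxdeg (bigD1 (i, j)) //= mxE !eqxx /= big1 // => -[p q] /=.
by rewrite xpair_eqE mxE => /negbTE ->.
Qed.

Lemma mxmonomial_unit m n (H : 'M[R]_(m, n)) i j : mxmonomial H (mxunit i j) = H i j.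
Proof.
rewrite mxmonomialE (bigD1 (i, j)) //= mxE !eqxx /= expr1 big1 ?mulr1 // => -[p q] /=.
by rewrite xpair_eqE mxE => /negbTE ->; rewrite expr0.
Qed.

Lemma sum_mxdeg1 m n k (phi : 'M[nat]_(m, n) -> R) :
  \sum_(a : 'M['I_k.+2]_(m, n) | mxdeg (map_mx (@nat_of_ord k.+2) a) == 1%N)
    phi (map_mx (@nat_of_ord k.+2) a) = \sum_i \sum_j phi (mxunit i j).
Proof.
rewrite pair_bigA /=.
under eq_bigr => a /eqP da.
  rewrite -[phi _]mulr1n -da /mxdeg -sumrMnr.
  over.
rewrite exchange_big /=; apply: eq_bigr => -[i j] _ /=.
pose b : 'M['I_k.+2]_(m, n) := \matrix_(p, q) inord ((p == i) && (q == j)).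
have bE : map_mx (@nat_of_ord k.+2) b = mxunit i j.
  apply/matrixP => p q; rewrite !mxE inordK //; by case: (_ && _).
rewrite (bigD1 b) /=; last by rewrite bE mxdeg_unit.
rewrite bE mxE !eqxx mulr1n big1 ?addr0 // => a /andP[/eqP da ab].
case: (eqVneq (map_mx (@nat_of_ord k.+2) a i j) 0%N) => [->|aij]; first by rewrite mulr0n.
case/negP: ab; apply/eqP/matrixP => p q; apply: val_inj => /=.
have /matrixP /(_ p q) := mxdeg1P da aij; rewrite -bE mxE => ->.
by rewrite mxE.
Qed.

Lemma mxtrace_dot m n (L H : 'M[R]_(m, n)) :
  \tr (L^T *m H) = \sum_i \sum_j L i j * H i j.
Proof.
rewrite /mxtrace exchange_big /=; apply: eq_bigr => j _.
by rewrite mxE; apply: eq_bigr => i _; rewrite mxE.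
Qed.

Lemma mxtrace_dot_delta m n (L : 'M[R]_(m, n)) i j :
  \tr (L^T *m delta_mx i j) = L i j.
Proof.
rewrite mxtrace_dot.
rewrite (bigD1 i) //= (bigD1 j) //= big1 ?addr0; last first.
  by move=> q qj; rewrite mxE (negbTE qj) andbF mulr0.
rewrite big1 ?addr0; last first.
  by move=> p pi; apply: big1 => q _; rewrite mxE (negbTE pi) mulr0.
by rewrite mxE !eqxx mulr1.
Qed.

Lemma mx_analytic_strict m n (f : 'M[R]_(m, n) -> R) (A : 'M[R]_(m, n)) :
  mx_analytic f ->
  exists (L : 'M[R]_(m, n)) (C del : R), [/\ 0 <= C, 0 < del &
    forall (B B' : 'M[R]_(m, n)) (M : R), 0 < M -> M <= del ->
      `|B - A| <= M -> `|B' - A| <= M ->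
      `|f B - f B' - \tr (L^T *m (B - B'))| <= C * M * `|B - B'|].
Proof.
move=> /(_ A) [c [r [r0 Hf]]].
pose rho := r / 2; have rho0 : 0 < rho by rewrite /rho; lra.
(* At the constant matrix rho every monomial of degree d equals rho^d, so summability at this one
   point bounds all coefficients together. *)
have nrho : `|const_mx rho : 'M[R]_(m, n)| < r.
  apply: (@le_lt_trans _ _ rho); last by rewrite /rho; lra.
  by apply: mx_normr_le => [|i j]; rewrite ?mxE ?gtr0_norm // ltW.
have [/summable_sum_bound [K HK] _] := Hf _ nrho.
have inj k : injective (map_mx (@nat_of_ord k) : 'M['I_k]_(m, n) -> _).
  move=> a b /matrixP H; apply/matrixP => i j; apply: val_inj => /=.
  by have := H i j; rewrite !mxE.
have {}HK k : \sum_(a : 'M['I_k]_(m, n)) `|c (map_mx (@nat_of_ord k) a)| *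
    rho ^+ mxdeg (map_mx (@nat_of_ord k) a) <= K.
  apply: le_trans (HK _ _ (inj k)); apply: ler_sum => a _.
  rewrite normrM mxmonomialE.
  under eq_bigr do rewrite mxE.
  by rewrite prodrXr normrX (gtr0_norm rho0).
have K0 : 0 <= K.
  apply: le_trans (HK 0%N); apply: sumr_ge0 => a _.
  by rewrite mulr_ge0 // exprn_ge0 // ltW.
(* Only the 8 of [mulrn_expr_le] enters: the coefficients are already summable against rho^d, and
   the decay 2^-d is bounded by 1. *)
pose C := 8 * K / rho ^+ 2.
exists (\matrix_(i, j) c (mxunit i j)), C, (rho / 4).
have r2 : 0 < rho ^+ 2 by rewrite exprn_gt0.
split; [by rewrite /C divr_ge0 ?sqr_ge0 //; lra|lra|].
move=> B B' M M0 Mr BM B'M.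
have Br : `|B - A| < r by apply: le_lt_trans BM _; rewrite /rho in Mr *; lra.
have B'r : `|B' - A| < r by apply: le_lt_trans B'M _; rewrite /rho in Mr *; lra.
pose mono (H : 'M[R]_(m, n)) k (a : 'M['I_k]_(m, n)) :=
  mxmonomial H (map_mx (@nat_of_ord k) a).
pose g k := \sum_(a : 'M['I_k]_(m, n)) c (map_mx (@nat_of_ord k) a) * mono (B - A) k a
  - \sum_(a : 'M['I_k]_(m, n)) c (map_mx (@nat_of_ord k) a) * mono (B' - A) k a
  - \tr ((\matrix_(i, j) c (mxunit i j))^T *m (B - B')).
have gl : g k @[k --> \oo] --> f B - f B' - \tr ((\matrix_(i, j) c (mxunit i j))^T *m (B - B')).
  have [_ h1] := Hf _ Br; have [_ h2] := Hf _ B'r.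
  rewrite subrKC in h1; rewrite subrKC in h2.
  by apply: cvgB; [exact: cvgB|exact: cvg_cst].
have ngl : `|g k| @[k --> \oo] -->
    `|f B - f B' - \tr ((\matrix_(i, j) c (mxunit i j))^T *m (B - B'))|.
  exact: cvg_norm.
apply: (@ler_cvg_to _ _ _ _ _ (cst (C * M * `|B - B'|)) _ _ ngl).
  exact: cvg_cst.
(* From this bound on, the partial sums contain all multi-indices of degree 1, which make up the
   linear part. *)
exists 2%N => // -[|[|k]] //= _.
pose phi (a : 'M[nat]_(m, n)) := c a * (mxmonomial (B - A) a - mxmonomial (B' - A) a).
have -> : g k.+2 = \sum_(a : 'M['I_k.+2]_(m, n) |
     (2 <= mxdeg (map_mx (@nat_of_ord k.+2) a))%N) phi (map_mx (@nat_of_ord k.+2) a).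
  rewrite /g -sumrB.
  have -> : \tr ((\matrix_(i, j) c (mxunit i j))^T *m (B - B')) =
      \sum_i \sum_j phi (mxunit i j).
    rewrite mxtrace_dot; apply: eq_bigr => i _; apply: eq_bigr => j _.
    by rewrite /phi !mxmonomial_unit !mxE; ring.
  under eq_bigr do rewrite -mulrBr -/(phi _).
  rewrite -(sum_mxdeg1 k) (bigID (fun a => 2 <= mxdeg (map_mx (@nat_of_ord k.+2) a))%N) /=.
  rewrite -addrA [X in _ + X](_ : _ = 0) ?addr0 //.
  apply/eqP; rewrite subr_eq0; apply/eqP.
  (* Below degree 2, what remains besides degree 1 is the zero multi-index, whose monomial takes the
     same value at both points. *)
  rewrite big_mkcond [RHS]big_mkcond /=; apply: eq_bigr => a _.
  case: ltngtP => //=; case E: (mxdeg _) => [|] //= _.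
  rewrite /phi !mxmonomialE.
  have a0 ij : map_mx (@nat_of_ord k.+2) a ij.1 ij.2 = 0%N.
    apply/eqP; rewrite -leqn0 -E /mxdeg (bigD1 ij) //=; exact: leq_addr.
  rewrite !big1 ?subrr ?mulr0 // => ij _; by rewrite a0 expr0.
apply: le_trans (ler_norm_sum _ _ _) _.
have T (a : 'M[nat]_(m, n)) : (2 <= mxdeg a)%N ->
    `|phi a| <= 8 / rho ^+ 2 * M * `|B - B'| * (`|c a| * rho ^+ mxdeg a).
  move=> a2.
  have B1 : M * `|mxmonomial (B - A) a - mxmonomial (B' - A) a| <=
      (mxdeg a)%:R * M ^+ mxdeg a * `|B - B'|.
    rewrite !mxmonomialE /mxdeg; apply: normB_prod_expr_le; first exact: ltW.
    - by move=> ij; apply: le_trans BM; exact: mx_normr_entry.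
    - by move=> ij; apply: le_trans B'M; exact: mx_normr_entry.
    - move=> ij; have := mx_normr_entry (B - B') ij.1 ij.2.
      by rewrite !mxE; congr (`|_| <= _); ring.
  have B2 := @mulrn_expr_le R M rho (mxdeg a) a2 (ltW M0) ltac:(lra).
  rewrite /phi normrM -(ler_pM2r (mulr_gt0 M0 r2)).
  set D := `|B - B'| in B1 *; have D0 : 0 <= D by exact: normr_ge0.
  set E := `|mxmonomial _ _ - _| in B1 *.
  have -> : `|c a| * E * (M * rho ^+ 2) = `|c a| * (M * E) * rho ^+ 2 by ring.
  apply: (@le_trans _ _ (`|c a| * ((mxdeg a)%:R * M ^+ mxdeg a * D) * rho ^+ 2)).
    by apply: ler_wpM2r; [exact: ltW|exact: ler_wpM2l].
  have -> : `|c a| * ((mxdeg a)%:R * M ^+ mxdeg a * D) * rho ^+ 2 =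
    `|c a| * D * ((mxdeg a)%:R * M ^+ mxdeg a * rho ^+ 2) by ring.
  apply: (@le_trans _ _ (`|c a| * D * (8 * M ^+ 2 * rho ^+ mxdeg a))).
    apply: ler_wpM2l; first exact: mulr_ge0.
    apply: le_trans B2 _; apply: ler_wpM2l; first by rewrite mulr_ge0 ?sqr_ge0.
    apply: ler_piMr; first by apply: exprn_ge0; exact: ltW.
    apply: exprn_ile1; lra.
  rewrite le_eqVlt; apply/orP; left; apply/eqP; field; lra.
apply: (@le_trans _ _ (\sum_(a : 'M['I_k.+2]_(m, n))
  8 / rho ^+ 2 * M * `|B - B'| * (`|c (map_mx (@nat_of_ord k.+2) a)| *
    rho ^+ mxdeg (map_mx (@nat_of_ord k.+2) a)))).
  rewrite big_mkcond; apply: ler_sum => a _; case: ifP => [|_]; first exact: T.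
  by rewrite !mulr_ge0 ?invr_ge0 ?sqr_ge0 ?exprn_ge0 // ltW.
rewrite -mulr_sumr.
have Q0 : 0 <= 8 / rho ^+ 2 * M * `|B - B'|.
  by rewrite !mulr_ge0 ?invr_ge0 ?sqr_ge0 // ltW.
apply: le_trans (ler_wpM2l Q0 (HK _)) _.
by rewrite /C le_eqVlt; apply/orP; left; apply/eqP; ring.
Qed.

(** The quotient is taken at any B near A: B = A gives the directional derivatives, and B close to A
    the continuity of the gradient. *)
Lemma strict_directional m n (f : 'M[R]_(m, n) -> R) (A L : 'M[R]_(m, n)) (C del : R) :
  0 <= C -> 0 < del ->
  (forall (B B' : 'M[R]_(m, n)) (M : R), 0 < M -> M <= del ->
      `|B - A| <= M -> `|B' - A| <= M ->
      `|f B - f B' - \tr (L^T *m (B - B'))| <= C * M * `|B - B'|) ->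
  forall B v M, `|B - A| < M -> M <= del ->
    \forall h \near (0 : R)^',
      `|h^-1 * (f (h *: v + B) - f B) - \tr (L^T *m v)| <= C * M * `|v|.
Proof.
move=> C0 del0 H B v M BM Mdel.
have M0 : 0 < M by apply: le_lt_trans BM.
near=> h.
have h0 : h != 0 by near: h; exact: nbhs_dnbhs_neq.
have v1 : 0 < `|v| + 1 by rewrite ltr_wpDl.
have hd : `|h| < (M - `|B - A|) / (`|v| + 1).
  by near: h; apply: dnbhs0_lt; rewrite divr_gt0 // subr_gt0.
have hv : `|h *: v| <= M - `|B - A|.
  rewrite normrZ; move: hd; rewrite ltr_pdivlMr // => /ltW; apply: le_trans.
  by rewrite ler_wpM2l // lerDl.
have -> : h^-1 * (f (h *: v + B) - f B) - \tr (L^T *m v) =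
    h^-1 * (f (h *: v + B) - f B - \tr (L^T *m (h *: v + B - B))).
  by rewrite addrK -scalemxAr mxtraceZ; field.
rewrite normrM normfV mulrC ler_pdivrMr ?normr_gt0 //.
have P : `|h *: v + B - A| <= M.
  by rewrite -addrA; apply: le_trans (ler_normD _ _) _; lra.
have := H _ B M M0 Mdel P (ltW BM).
rewrite addrK normrZ => /le_trans; apply.
by rewrite mulrA mulrAC.
Unshelve. all: by end_near. Qed.

Lemma mx_analytic_directional m n (f : 'M[R]_(m, n) -> R) (A v : 'M[R]_(m, n)) :
  mx_analytic f ->
  h^-1 *: ((f (h *: v + A) : R^o) - f A) @[h --> (0 : R)^'] -->
    (\tr ((mxgrad f A)^T *m v) : R^o).
Proof.
move=> Hf.
have [L [C [del [C0 del0 H]]]] := mx_analytic_strict A Hf.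
have D w : h^-1 *: ((f (h *: w + A) : R^o) - f A) @[h --> (0 : R)^'] -->
    (\tr (L^T *m w) : R^o).
  apply/cvgrPdist_le => e e0.
  pose M := Num.min del (e / (C * `|w| + 1)).
  have w1 : 0 < C * `|w| + 1 by rewrite ltr_wpDl // mulr_ge0.
  have M0 : 0 < M by rewrite lt_min del0 divr_gt0.
  have Mdel : M <= del by rewrite ge_min lexx.
  have AM : `|A - A| < M by rewrite subrr normr0.
  have := strict_directional C0 del0 H w AM Mdel.
  apply: filterS => h Hh; rewrite distrC; apply: le_trans Hh _.
  have : M <= e / (C * `|w| + 1) by rewrite ge_min lexx orbT.
  rewrite ler_pdivlMr // => H1; rewrite mulrAC; apply: le_trans H1.
  by rewrite mulrC ler_pM2l // lerDl.
suff -> : mxgrad f A = L by [].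
apply/matrixP => i j; rewrite mxE.
have := D (delta_mx i j); rewrite mxtrace_dot_delta => Dij.
exact: (cvg_lim _ Dij).
Qed.

Lemma mxgrad_continuous m n (f : 'M[R]_(m, n) -> R) :
  mx_analytic f -> continuous (mxgrad f).
Proof.
move=> Hf A.
have [L [C [del [C0 del0 H]]]] := mx_analytic_strict A Hf.
have B1 (B : 'M[R]_(m, n)) M i j : `|B - A| < M -> M <= del -> `|mxgrad f B i j - L i j| <= C * M.
  move=> BM Mdel.
  have M0 : 0 < M by apply: le_lt_trans BM.
  have d1 : `|delta_mx i j : 'M[R]_(m, n)| <= 1.
    apply: mx_normr_le => // p q; rewrite mxE normr_nat.
    by case: (_ && _).
  have nB := strict_directional C0 del0 H (delta_mx i j) BM Mdel.
  have lB := @mx_analytic_directional m n f B (delta_mx i j) Hf.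
  rewrite !mxtrace_dot_delta in nB lB.
  have lB2 : `|h^-1 * (f (h *: delta_mx i j + B) - f B) - L i j|
      @[h --> (0 : R)^'] --> `|mxgrad f B i j - L i j|.
    by apply: cvg_norm; apply: cvgB; [exact: lB|exact: cvg_cst].
  apply: (@ler_cvg_to _ _ _ _ _ (cst (C * M)) _ _ lB2); first exact: cvg_cst.
  apply: filterS nB => h /le_trans; apply => /=.
  by rewrite ler_piMr // mulr_ge0 // ltW.
(* [B1] at B = A holds for arbitrarily small M, which forces equality of the entries. *)
have BA : mxgrad f A = L.
  apply/matrixP => i j; apply/eqP; rewrite -subr_eq0 -normr_le0.
  apply/ler_addgt0Pl => e e0; rewrite addr0.
  have C1 : 0 < C + 1 by lra.
  pose M := Num.min del (e / (C + 1)).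
  have M0 : 0 < M by rewrite lt_min del0 divr_gt0.
  have := B1 A M i j; rewrite subrr normr0 ge_min lexx => /(_ M0 isT) /le_trans; apply.
  have : M <= e / (C + 1) by rewrite ge_min lexx orbT.
  rewrite ler_pdivlMr // => H1; apply: le_trans H1; rewrite mulrC ler_pM2l //; lra.
rewrite /continuous_at BA.
apply/(@cvg_mxP _ _ (nbhs A) (nbhs_filter A)) => i j; apply/cvgrPdist_le => e e0.
have C1 : 0 < C + 1 by lra.
pose M := Num.min del (e / (C + 1)).
have M0 : 0 < M by rewrite lt_min del0 divr_gt0.
apply/nbhs_ballP; exists M => //= B.
rewrite mx_norm_ball /ball_ /= distrC => BM; rewrite distrC.
have Md : M <= del by rewrite ge_min lexx.
apply: le_trans (B1 B M i j BM Md) _.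
have : M <= e / (C + 1) by rewrite ge_min lexx orbT.
rewrite ler_pdivlMr // => H1; apply: le_trans H1; rewrite mulrC ler_pM2l //; lra.
Qed.

End MatrixAnalytic.

(** * Gradient flow of a matrix product *)

Section Chains.
Context {R : realType} (dims : nat -> nat).
Implicit Types W : layers R dims.

(* The product W_{n-1} ... W_{j+1}, a junk value if [n <= j]. *)
Fixpoint upper_chain W (n j : nat) : 'M[R]_(dims n, dims j.+1) :=
  if n is k.+1 then
    if k == j then conform_mx 0 (1%:M : 'M[R]_(dims k.+1))
    else W k *m upper_chain W k j
  else 0.

Lemma upper_chain_last W n : upper_chain W n.+1 n = 1%:M.
Proof. by rewrite /= eqxx conform_mx_id. Qed.

Lemma upper_chainS W n j : (j < n)%N ->
  upper_chain W n.+1 j = W n *m upper_chain W n j.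
Proof. by move=> jn /=; rewrite gtn_eqF. Qed.

Lemma upper_chain_step W n j : (j.+1 < n)%N ->
  upper_chain W n j = upper_chain W n j.+1 *m W j.+1.
Proof.
elim: n => // n IH; rewrite ltnS leq_eqVlt => /orP[/eqP <-|jn].
  by rewrite upper_chainS // !upper_chain_last mulmx1 mul1mx.
by rewrite !upper_chainS ?(ltnW jn) // IH // mulmxA.
Qed.

Lemma mxchain_split W n j : (j < n)%N ->
  mxchain W n = upper_chain W n j *m W j *m mxchain W j.
Proof.
elim: n => // n IH; rewrite ltnS leq_eqVlt => /orP[/eqP <-|jn].
  by rewrite upper_chain_last mul1mx.
by rewrite upper_chainS // -!mulmxA [LHS]/= IH // !mulmxA.
Qed.

Lemma eq_mxchain W W' n : (forall i, (i < n)%N -> W i = W' i) ->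
  mxchain W n = mxchain W' n.
Proof.
elim: n => // n IH H /=; rewrite H // IH // => i ni; exact/H/ltnW.
Qed.

Lemma eq_upper_chain W W' n j : (j < n)%N -> (forall i, (j < i)%N -> W i = W' i) ->
  upper_chain W n j = upper_chain W' n j.
Proof.
move=> + H; elim: n => // n IH; rewrite ltnS leq_eqVlt => /orP[/eqP <-|jn].
  by rewrite !upper_chain_last.
by rewrite !upper_chainS // IH // H.
Qed.

Lemma mxchain_dfwith W n j (A : 'M[R]_(dims j.+1, dims j)) : (j < n)%N ->
  mxchain (@dfwith nat (fun i => 'M[R]_(dims i.+1, dims i)) W j A) n =
  upper_chain W n j *m A *m mxchain W j.
Proof.
move=> jn; rewrite (mxchain_split _ jn) dfwithin.
congr (_ *m _ *m _).
  by apply: eq_upper_chain => // i ji; rewrite dfwithout // ltn_eqF.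
by apply: eq_mxchain => i ij; rewrite dfwithout // gtn_eqF.
Qed.

(** The product is linear in layer j, so the difference quotient of the composed loss in a direction
    E is exactly that of [l] in the direction L E Q. Cyclicity of the trace then moves L and Q onto
    the gradient. *)
Lemma layer_gradE N (l : 'M[R]_(dims N, dims 0%N) -> R) W j :
  mx_analytic l -> (j < N)%N ->
  layer_grad l W j =
    (upper_chain W N j)^T *m mxgrad l (mxchain W N) *m (mxchain W j)^T.
Proof.
move=> Hl jN; apply/matrixP => p q; rewrite mxE.
set L := upper_chain W N j; set Q := mxchain W j.
rewrite -[RHS]mxtrace_dot_delta !trmx_mul !trmxK.
have -> : \tr (Q *m ((mxgrad l (mxchain W N))^T *m L) *m delta_mx p q) =
   \tr ((mxgrad l (mxchain W N))^T *m (L *m delta_mx p q *m Q)).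
  by rewrite -[Q *m _ *m _]mulmxA mxtrace_mulC !mulmxA.
have := @mx_analytic_directional R _ _ l (mxchain W N) (L *m delta_mx p q *m Q) Hl.
set v := L *m _ *m Q => D; rewrite /derive.
rewrite (_ : (fun h => _) = fun h => h^-1 *: ((l (h *: v + mxchain W N) : R^o) - l (mxchain W N))).
  exact: (cvg_lim _ D).
apply/funext => h /=.
rewrite /overparam_loss !mxchain_dfwith // (mxchain_split W jN).
by rewrite /shift /= mulmxDr mulmxDl -scalemxAr -scalemxAl.
Qed.

(** [(W j.+1)^T] times the gradient in layer [j.+1], and the gradient in layer [j] times [(W j)^T],
    are the same matrix, each factor being absorbed into the adjacent chain. Hence the defect of
    balancedness has zero derivative. *)
Lemma balanced_flow N (l : 'M[R]_(dims N, dims 0%N) -> R) (W : R -> layers R dims) :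
  mx_analytic l -> gradient_flow l W -> balanced N (W 0) ->
  forall t, 0 <= t -> balanced N (W t).
Proof.
move=> Hl Hf Hb t t0 j jN.
apply/eqP; rewrite -subr_eq0; apply/eqP.
rewrite (_ : 0 = (W 0 j.+1)^T *m W 0 j.+1 - W 0 j *m (W 0 j)^T); last first.
  by rewrite Hb // subrr.
apply: (has_time_derivative0_cst
  (f := fun s => (W s j.+1)^T *m W s j.+1 - W s j *m (W s j)^T)) => // s s0.
have D1 := Hf s j.+1 s0 jN; have D0 := Hf s j s0 (ltnW jN).
have D1T := has_time_derivative_trmx D1; have D0T := has_time_derivative_trmx D0.
have := has_time_derivativeB (has_time_derivative_mulmx D1T D1)
  (has_time_derivative_mulmx D0 D0T).
congr (has_time_derivative _ _ _).
rewrite !layer_gradE // ?(ltnW jN) // (upper_chain_step _ jN) /=.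
set G := mxgrad _ _; set L := upper_chain _ _ _; set Q := mxchain _ _.
rewrite !(linearN, mulNmx, mulmxN) /= !trmx_mul !trmxK !mulmxA.
by apply/eqP; rewrite subr_eq0 addrC.
Qed.

(** Balancedness replaces [W j *m (W j)^T] by [(W j.+1)^T *m W j.+1], so that the Gram matrix of the
    next layer emerges one place further left, until A comes out. The induction descends from j =
    n. *)
Lemma upper_chain_intertwine n W : balanced n.+1 W -> forall j, (j <= n)%N ->
  upper_chain W n.+1 j *m W j *m (W j)^T =
  W n *m (W n)^T *m upper_chain W n.+1 j.
Proof.
move=> Hb j jn; rewrite -(subKn jn); elim: (n - j)%N (leq_subr j n) => [|k IH] kn.
  by rewrite subn0 upper_chain_last mul1mx mulmx1.
have E : (n - k = (n - k.+1).+1)%N by rewrite subnSK.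
have := IH (ltnW kn); rewrite E => IH'.
have jn1 : ((n - k.+1).+1 < n.+1)%N by rewrite -E ltnS leq_subr.
by rewrite (upper_chain_step _ jn1) -!mulmxA -(Hb _ jn1) !mulmxA IH'.
Qed.

Lemma upper_chain_gram n W : balanced n.+1 W -> forall j, (j <= n)%N ->
  upper_chain W n.+1 j *m (upper_chain W n.+1 j)^T = (W n *m (W n)^T) ^+ (n - j).
Proof.
move=> Hb j jn.
suff H k : (k <= n)%N -> upper_chain W n.+1 (n - k) *m (upper_chain W n.+1 (n - k))^T =
    (W n *m (W n)^T) ^+ k by have := H _ (leq_subr j n); rewrite subKn.
elim: k => [|k IH] kn; first by rewrite subn0 upper_chain_last trmx1 mulmx1.
have E : (n - k = (n - k.+1).+1)%N by rewrite subnSK.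
have := IH (ltnW kn); rewrite E => IH'.
have jn1 : ((n - k.+1).+1 < n.+1)%N by rewrite -E ltnS leq_subr.
rewrite (upper_chain_step _ jn1) trmx_mul !mulmxA upper_chain_intertwine //.
by rewrite -mulmxA IH' exprS.
Qed.

(** Mirror image: the Gram matrix of a layer travels to the right and comes out as B. *)
Lemma mxchain_intertwine n W : balanced n.+1 W -> forall j, (j <= n)%N ->
  (W j)^T *m W j *m mxchain W j = mxchain W j *m ((W 0%N)^T *m W 0%N).
Proof.
move=> Hb; elim=> [|j IH] jn; first by rewrite mulmx1 mul1mx.
by rewrite Hb //= !mulmxA -mulmxA -mulmxA (mulmxA _ (W j)) IH ?(ltnW jn) // !mulmxA.
Qed.

Lemma mxchain_gram n W : balanced n.+1 W -> forall j, (j <= n.+1)%N ->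
  (mxchain W j)^T *m mxchain W j = ((W 0%N)^T *m W 0%N) ^+ j.
Proof.
move=> Hb; elim=> [|j IH] jn; first by rewrite trmx1 mulmx1.
rewrite /= trmx_mul !mulmxA -mulmxA -mulmxA (mulmxA _ (W j)).
by rewrite (mxchain_intertwine Hb) // mulmxA IH ?(ltnW jn) // exprSr.
Qed.

Lemma mxchain_gramr n W : balanced n.+1 W ->
  mxchain W n.+1 *m (mxchain W n.+1)^T = (W n *m (W n)^T) ^+ n.+1.
Proof.
move=> Hb; rewrite (@mxchain_split W n.+1 0%N) // mulmx1 trmx_mul !mulmxA.
by rewrite upper_chain_intertwine // -mulmxA upper_chain_gram // subn0 exprS.
Qed.

Lemma has_time_derivative_mxchain (W : R -> layers R dims) (dW : layers R dims) t k :
  (forall j, (j < k)%N -> has_time_derivative (fun s => W s j) t (dW j)) ->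
  has_time_derivative (fun s => mxchain (W s) k) t
    (\sum_(j < k) upper_chain (W t) k j *m dW j *m mxchain (W t) j).
Proof.
elim: k => [|k IH] H.
  by rewrite big_ord0 /=; exact: has_time_derivative_cst.
have D1 := H k (ltnSn k).
have D2 := IH (fun j jk => H j (ltnW jk)).
have := has_time_derivative_mulmx D1 D2.
congr (has_time_derivative _ _ _).
rewrite big_ord_recr /= eqxx conform_mx_id mul1mx addrC; congr (_ + _).
rewrite mulmx_sumr; apply: eq_bigr => j _.
by rewrite gtn_eqF // !mulmxA.
Qed.

(** In each Leibniz term the chains above and below the layer meet their own transposes, supplied by
    the layer gradient; these Gram matrices are powers of A and B. *)
Lemma has_time_derivative_flow n (l : 'M[R]_(dims n.+1, dims 0%N) -> R)
    (W : R -> layers R dims) t :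
  mx_analytic l -> gradient_flow l W -> balanced n.+1 (W 0) -> 0 <= t ->
  has_time_derivative (fun s => mxchain (W s) n.+1) t
    (- \sum_(j < n.+1) (W t n *m (W t n)^T) ^+ (n - j) *m
       mxgrad l (mxchain (W t) n.+1) *m ((W t 0%N)^T *m W t 0%N) ^+ j).
Proof.
move=> Hl Hf Hb t0; have Hbt := balanced_flow Hl Hf Hb t0.
have := @has_time_derivative_mxchain W _ t n.+1 (fun j jn => Hf t j t0 jn).
congr (has_time_derivative _ _ _).
rewrite -sumrN; apply: eq_bigr => j _.
rewrite layer_gradE // mulmxN mulNmx; congr (- _).
have jn : (j <= n)%N by rewrite -ltnS.
rewrite -(upper_chain_gram Hbt jn) -(mxchain_gram Hbt (ltnW (ltn_ord j))).
by rewrite !mulmxA.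
Qed.

End Chains.

(** * Roots of Gram matrices and differentiation of the decomposition *)

Section GramRoot.
Context {R : realType}.

Lemma col_sqnorm_eq0 m (v : 'cV[R]_m) : (v^T *m v) 0 0 = 0 -> v = 0.
Proof.
rewrite mxE => /eqP; rewrite psumr_eq0 => [/allP H|i _]; last first.
  by rewrite mxE -expr2 sqr_ge0.
apply/matrixP => i j; rewrite (ord1 j) [RHS]mxE.
have := H i (mem_index_enum i); rewrite mxE -expr2 sqrf_eq0 /=.
by move/eqP.
Qed.

Lemma col_sqnorm_ge0 m (v : 'cV[R]_m) : 0 <= (v^T *m v) 0 0.
Proof. by rewrite mxE sumr_ge0 // => i _; rewrite mxE -expr2 sqr_ge0. Qed.

Variables (m p : nat) (X : 'M[R]_(m, p)).
Let A : 'M[R]_m := X *m X^T.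

Let trA : A^T = A. Proof. by rewrite /A trmx_mul trmxK. Qed.

Let AS k : A ^+ k.+1 = A *m A ^+ k. Proof. exact: exprS. Qed.
Let ASr k : A ^+ k.+1 = A ^+ k *m A. Proof. exact: exprSr. Qed.

Lemma trmx_gram_pow k : (A ^+ k)^T = A ^+ k.
Proof.
elim: k => [|k IH]; first by rewrite !expr0 trmx1.
by rewrite [in LHS]AS trmx_mul IH trA ASr.
Qed.

Lemma gram_pow_ge0 k (v : 'cV[R]_m) : 0 <= (v^T *m A ^+ k *m v) 0 0.
Proof.
(* Two consecutive exponents are treated together because A^(k+2) = A A^k A advances by two. *)
suff [] : (forall v : 'cV[R]_m, 0 <= (v^T *m A ^+ k *m v) 0 0) /\
  (forall v : 'cV[R]_m, 0 <= (v^T *m A ^+ k.+1 *m v) 0 0) by [].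
elim: k => [|k [IH IH1]]; split=> // {}v.
- by rewrite expr0 mulmx1 col_sqnorm_ge0.
- have -> : v^T *m A ^+ 1 *m v = (X^T *m v)^T *m (X^T *m v).
    by rewrite expr1 /A trmx_mul trmxK !mulmxA.
  exact: col_sqnorm_ge0.
- have -> : v^T *m A ^+ k.+2 *m v = (A *m v)^T *m A ^+ k *m (A *m v).
    by rewrite AS ASr trmx_mul trA !mulmxA.
  exact: IH.
Qed.

(** The identity |A^(k+1) u|^2 = u^T A^k (A^(k+2) u) lowers the exponent by one. *)
Lemma gram_pow_ker k (u : 'cV[R]_m) : A ^+ k.+1 *m u = 0 -> A *m u = 0.
Proof.
elim: k => [|k IH]; first by rewrite expr1.
move=> H; apply: IH; apply: col_sqnorm_eq0.
rewrite trmx_mul trmx_gram_pow.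
have -> : u^T *m A ^+ k.+1 *m (A ^+ k.+1 *m u) = u^T *m A ^+ k *m (A ^+ k.+2 *m u).
  by rewrite {1}ASr [A ^+ k.+2]AS !mulmxA.
by rewrite H mulmx0 mxE.
Qed.

(* [A^k u - a^k u = q(A) (A u - a u)] where [q(A)] has nonnegative terms and
   constant term [a^(k-1)]. *)
Lemma gram_pow_eigen k (a : R) (u : 'cV[R]_m) : 0 <= a ->
  A ^+ k.+1 *m u = a ^+ k.+1 *: u -> A *m u = a *: u.
Proof.
(* For a = 0 and k > 0 the lower bound a^k |v|^2 used below says nothing; the kernel lemma settles
   this case. *)
rewrite le_eqVlt => /orP[/eqP <-|a0].
  by rewrite expr0n /= !scale0r; exact: gram_pow_ker.
move=> H; pose v := A *m u - a *: u.
suff v0 : v = 0 by apply/eqP; rewrite -subr_eq0; apply/eqP.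
apply: col_sqnorm_eq0.
pose q j := (v^T *m (A ^+ j *m u - a ^+ j *: u)) 0 0.
have qS j : q j.+1 = (v^T *m A ^+ j *m v) 0 0 + a * q j.
  have E : A ^+ j.+1 *m u - a ^+ j.+1 *: u =
      A ^+ j *m v + a *: (A ^+ j *m u - a ^+ j *: u).
    rewrite /v mulmxBr scalerBr scalerA -exprS ASr -mulmxA -scalemxAr.
    by rewrite addrA subrK.
  by rewrite /q E mulmxDr mulmxA -scalemxAr !mxE.
have qge j : a ^+ j * (v^T *m v) 0 0 <= q j.+1.
  elim: j => [|j IH].
    rewrite qS !expr0 mulmx1 mul1r /q !expr0 mul1mx scale1r subrr mulmx0.
    by rewrite [X in _ <= _ + _ * X]mxE mulr0 addr0.
  rewrite qS exprS -mulrA; apply: (@le_trans _ _ (a * q j.+1)).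
    by rewrite ler_pM2l.
  by rewrite lerDr gram_pow_ge0.
have := qge k; rewrite {1}/q H subrr mulmx0 [X in _ <= X]mxE.
rewrite pmulr_rle0 ?exprn_gt0 // => h.
by apply/eqP; rewrite eq_le h col_sqnorm_ge0.
Qed.

Let eq_mx_col q r (M M' : 'M[R]_(q, r)) :
  (forall i, M *m delta_mx i 0 = M' *m delta_mx i (0 : 'I_1)) -> M = M'.
Proof.
move=> H; apply/matrixP => i j; have := H j; rewrite -!colE => /matrixP /(_ i 0).
by rewrite !mxE.
Qed.

Let diag_delta q (d : 'rV[R]_q) r :
  diag_mx d *m delta_mx r (0 : 'I_1) = d 0 r *: delta_mx r 0.
Proof.
apply/matrixP => i j; rewrite mul_diag_mx !mxE.
by case: eqVneq => [->|] //=; rewrite !mulr0.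
Qed.

(** The columns of U are eigenvectors of the power, hence of A; the range of 1 - U U^T lies in the
    kernel of the power, hence in that of A. Together they determine A even when U is not square. *)
Lemma gram_root k q (U : 'M[R]_(m, q)) (a : 'rV[R]_q) :
  U^T *m U = 1%:M -> (forall r, 0 <= a 0 r) ->
  A ^+ k.+1 = U *m diag_mx (\row_r a 0 r ^+ k.+1) *m U^T ->
  A = U *m diag_mx a *m U^T.
Proof.
move=> UU a0 H.
have AU : A *m U = U *m diag_mx a.
  apply: eq_mx_col => r.
  rewrite -[A *m U *m _]mulmxA -[U *m _ *m _]mulmxA diag_delta -scalemxAr.
  apply: (@gram_pow_eigen k) => //.
  by rewrite H -!mulmxA (mulmxA U^T) UU mul1mx diag_delta -scalemxAr mxE.
have AE : A *m (1%:M - U *m U^T) = 0.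
  apply: eq_mx_col => r; rewrite mul0mx -[A *m _ *m _]mulmxA; apply: (@gram_pow_ker k).
  rewrite H !mulmxA -(mulmxA _ U^T) mulmxBr mulmx1 mulmxA UU mul1mx subrr.
  by rewrite mulmx0 mul0mx.
have -> : A = A *m U *m U^T + A *m (1%:M - U *m U^T).
  by rewrite mulmxBr mulmx1 mulmxA addrCA subrr addr0.
by rewrite AE addr0 AU.
Qed.

End GramRoot.

(** * Linear algebra at a fixed time: rotational and normal parts of the derivative *)

Section SvdDerivative.
Context {R : realType} (m n k p : nat).
Variables (G : 'M[R]_(m, n)) (U dU : 'M[R]_(m, k)) (S dS : 'M[R]_k)
  (V dV : 'M[R]_(n, k)) (A : 'M[R]_m) (B : 'M[R]_n) (a : 'rV[R]_k).
Hypotheses (UU : U^T *m U = 1%:M) (VV : V^T *m V = 1%:M)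
  (dUU : dU^T *m U + U^T *m dU = 0) (dVV : dV^T *m V + V^T *m dV = 0)
  (Sd : is_diag_mx S) (dSd : is_diag_mx dS)
  (AE : A = U *m diag_mx a *m U^T) (BE : B = V *m diag_mx a *m V^T)
  (a0 : forall r, 0 <= a 0 r) (aS : forall r, a 0 r ^+ p.+1 = S r r ^+ 2)
  (dM : dU *m S *m V^T + U *m dS *m V^T + U *m S *m dV^T =
    - \sum_(j < p.+1) A ^+ (p - j) *m G *m B ^+ j).

Let D j := diag_mx (\row_r a 0 r ^+ j).

Let DS j : D j.+1 = diag_mx a *m D j.
Proof.
by rewrite /D mulmx_diag; congr diag_mx; apply/rowP => r; rewrite !mxE exprS.
Qed.

Let UA j : U^T *m A ^+ j = D j *m U^T.
Proof.
elim: j => [|j IH].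
  rewrite expr0 mulmx1 /D (_ : \row_r _ = const_mx 1) ?diag_const_mx ?mul1mx //.
  by apply/rowP => r; rewrite !mxE expr0.
rewrite exprS (_ : A * _ = A *m A ^+ j) // mulmxA {1}AE !mulmxA UU mul1mx.
by rewrite -mulmxA IH mulmxA DS.
Qed.

Let BV j : B ^+ j *m V = V *m D j.
Proof.
elim: j => [|j IH].
  rewrite expr0 mul1mx /D (_ : \row_r _ = const_mx 1) ?diag_const_mx ?mulmx1 //.
  by apply/rowP => r; rewrite !mxE expr0.
rewrite exprSr (_ : _ * B = B ^+ j *m B) // {2}BE -!mulmxA VV mulmx1.
by rewrite mulmxA IH -mulmxA DS diag_mx_comm.
Qed.

Let K := U^T *m G *m V.
Let X := U^T *m dU.
Let Y := dV^T *m V.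

Let XN r s : X s r = - X r s.
Proof.
have /matrixP /(_ s r) := dUU; rewrite [RHS]mxE [LHS]mxE => /eqP.
rewrite addrC addr_eq0 => /eqP ->; congr (- _); rewrite /X mxE [RHS]mxE.
by apply: eq_bigr => i _; rewrite mxE mulrC mxE.
Qed.

Let YN r s : Y s r = - Y r s.
Proof.
have /matrixP /(_ s r) := dVV; rewrite [RHS]mxE [LHS]mxE => /eqP.
rewrite addr_eq0 => /eqP ->; congr (- _); rewrite /Y mxE [RHS]mxE.
by apply: eq_bigr => i _; rewrite mxE mulrC mxE.
Qed.

Let Soff r s : r != s -> S r s = 0.
Proof. by move=> rs; move/is_diag_mxP: Sd; apply. Qed.

Let mulS q (M : 'M[R]_(q, k)) i r : (M *m S) i r = M i r * S r r.
Proof.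
rewrite mxE (bigD1 r) //= big1 ?addr0 // => s sr; by rewrite Soff // mulr0.
Qed.

Let Smul q (M : 'M[R]_(k, q)) i r : (S *m M) r i = S r r * M r i.
Proof.
rewrite mxE (bigD1 r) //= big1 ?addr0 // => s sr.
by rewrite Soff 1?eq_sym // mul0r.
Qed.

(** This is entry (r, s) of U^T W' V; the derivative of S drops out because it is diagonal. *)
Let Z r s : r != s ->
  X r s * S s s + S r r * Y r s =
    - (K r s * \sum_(j < p.+1) a 0 r ^+ (p - j) * a 0 s ^+ j).
Proof.
move=> rs.
have E : X *m S + dS + S *m Y = - \sum_(j < p.+1) D (p - j) *m K *m D j.
  have := congr1 (fun M => U^T *m M *m V) dM.
  rewrite !mulmxDr !mulmxDl !mulmxA UU !mul1mx -!(mulmxA _ V^T V) VV !mulmx1.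
  rewrite -/X => H.
  have {}H : X *m S + dS + S *m Y = U^T *m (- \sum_(j < p.+1) A ^+ (p - j) *m G *m B ^+ j) *m V.
    by rewrite -H /Y mulmxA.
  rewrite -[S *m _ *m V]mulmxA -/Y H mulmxN mulNmx mulmx_sumr mulmx_suml; congr (- _).
  by apply: eq_bigr => j _; rewrite !mulmxA UA -!mulmxA BV /K !mulmxA.
have /matrixP /(_ r s) := E; rewrite 2!mxE mulS Smul.
have -> : dS r s = 0 by move/is_diag_mxP: dSd; apply.
rewrite addr0 => ->; rewrite mxE summxE; congr (- _); rewrite mulr_sumr.
by apply: eq_bigr => j _; rewrite /D mul_mx_diag mxE mul_diag_mx !mxE; ring.
Qed.

(** Multiply [Z] at (r, s) by [S s s], at (s, r) by [S r r], and add: skew-symmetry makes the terms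
    in [Y] cancel. *)
Lemma left_rotation r s : a 0 r != a 0 s ->
  X r s = - ((a 0 s - a 0 r)^-1 * (K r s * S s s + S r r * K s r)).
Proof.
move=> ars; have rs : r != s by apply: contraNN ars => /eqP ->.
pose c u v := \sum_(j < p.+1) a 0 u ^+ (p - j) * a 0 v ^+ j.
have cE u v : (a 0 u - a 0 v) * c u v = S u u ^+ 2 - S v v ^+ 2.
  by rewrite -!aS subrXX.
have d0 : a 0 s - a 0 r != 0 by rewrite subr_eq0 eq_sym.
have csym : c s r = c r s.
  apply: (mulfI d0); rewrite cE -[a 0 s - _]opprB mulNr cE; ring.
have Z1 := Z rs; have := Z (r := s) (s := r); rewrite eq_sym => /(_ rs) Z2.
rewrite -/(c r s) in Z1; rewrite -/(c s r) csym XN YN in Z2.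
have e1 : X r s * (S s s ^+ 2 - S r r ^+ 2) =
    (X r s * S s s + S r r * Y r s) * S s s +
    S r r * (- X r s * S r r + S s s * - Y r s) by ring.
rewrite Z1 Z2 -cE csym in e1.
(* If c vanished, the nonnegative numbers a_r and a_s would have equal powers p + 1, hence be
   equal. *)
have c0 : c r s != 0.
  apply: contraNN ars => /eqP c0; have := cE r s; rewrite c0 mulr0 -!aS => /esym/eqP.
  by rewrite subr_eq0 eqrXn2.
apply: (mulIf (mulf_neq0 d0 c0)); rewrite e1; field; exact: d0.
Qed.

Let X0 r : X r r = 0.
Proof. by have := XN r r; lra. Qed.

Lemma left_normal i r :
  ((1%:M - U *m U^T) *m dU) i r * S r r =
  - ((1%:M - U *m U^T) *m G *m V) i r * a 0 r ^+ p.
Proof.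
set E := 1%:M - U *m U^T.
have EU : E *m U = 0 by rewrite /E mulmxBl mul1mx -mulmxA UU mulmx1 subrr.
clearbody E.
have EA q : E *m A ^+ q.+1 = 0.
  by rewrite exprS (_ : A * _ = A *m A ^+ q) // AE !mulmxA EU !mul0mx.
have H : E *m dU *m S = - (E *m G *m V *m D p).
  have := congr1 (fun M => E *m M *m V) dM.
  rewrite !mulmxDr !mulmxDl !mulmxA EU !mul0mx !addr0 -(mulmxA _ V^T V) VV mulmx1 => ->.
  rewrite mulmxN mulNmx mulmx_sumr mulmx_suml; congr (- _).
  rewrite big_ord_recr /= subnn expr0 big1 ?add0r; last first.
    by move=> [j jp] _ /=; rewrite -(subnSK jp) !mulmxA EA !mul0mx.
  by rewrite mul1mx -!mulmxA BV !mulmxA.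
have /matrixP /(_ i r) := H; rewrite mulS => ->.
by rewrite mxE /D mul_mx_diag !mxE mulNr.
Qed.

(** Splits dU into U X and its normal part. The latter enters as a hypothesis, since [left_normal]
    gives it only multiplied by [S r r], which may be zero. *)
Lemma left_flowE (P : 'M[R]_k) : is_diag_mx P ->
  (forall r, a 0 r = (S r r ^+ 2) `^ p.+1%:R^-1) ->
  (forall r s, r != s -> a 0 r != a 0 s) ->
  (forall i r, ((1%:M - U *m U^T) *m dU) i r =
    - ((1%:M - U *m U^T) *m G *m V) i r * P r r) ->
  dU = U_flow p.+1 G U S V P.
Proof.
move=> Pd aE adist HP.
have -> : dU = U *m X + (1%:M - U *m U^T) *m dU.
  by rewrite mulmxBl mul1mx /X mulmxA addrC subrK.
rewrite /U_flow; congr (_ + _).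
  rewrite -mulmxN; congr (_ *m _); apply/matrixP => r s.
  rewrite [RHS]mxE [X in - X]mxE [X in - (X * _)]mxE; case: eqVneq => [->|rs].
    by rewrite X0 mul0r oppr0.
  rewrite left_rotation ?adist // !aE; congr (- (_ * _)).
  rewrite [RHS]mxE mulS -(mulmxA S) -(mulmxA S) Smul; congr (_ * _ + _ * _).
  have -> : K s r = K^T r s by rewrite [RHS]mxE.
  by rewrite /K !trmx_mul trmxK !mulmxA.
apply/matrixP => i r; rewrite HP [RHS]mxE mulNr; congr (- _).
rewrite [RHS]mxE (bigD1 r) //= big1 ?addr0 // => s sr.
by move/is_diag_mxP: Pd => ->; rewrite ?mulr0.
Qed.

End SvdDerivative.

(** * Evolution of the singular vectors *)

Section Regularity.
Context {R : realType}.

(** Stronger than [svd_flow_well_defined], which tolerates a zero singular value when 1/2 - 1/N is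
    nonnegative; this form holds at all times close to, and distinct from, a given one. *)
Definition regular_spectrum k (S : 'M[R]_k) : Prop :=
  (forall r, S r r != 0) /\
  (forall r r', r != r' -> S r r ^+ 2 != S r' r' ^+ 2).

Definition root_spectrum k (p : nat) (S : 'M[R]_k) : 'rV[R]_k :=
  \row_r (S r r ^+ 2) `^ p.+1%:R^-1.

Lemma root_spectrum_ge0 k p (S : 'M[R]_k) r : 0 <= root_spectrum p S 0 r.
Proof. by rewrite mxE powR_ge0. Qed.

Lemma root_spectrumX k p (S : 'M[R]_k) r :
  root_spectrum p S 0 r ^+ p.+1 = S r r ^+ 2.
Proof.
rewrite mxE -powR_mulrn ?powR_ge0 // -powRrM mulVf ?pnatr_eq0 // powRr1 //.
exact: sqr_ge0.
Qed.

Lemma well_defined_of_distinct k p (S : 'M[R]_k) :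
  (forall r, S r r ^+ 2 != 0) ->
  (forall r r', r != r' -> S r r ^+ 2 != S r' r' ^+ 2) ->
  svd_flow_well_defined p.+1 S.
Proof.
move=> S0 Sd; split=> [r r' rr'|r]; last by right.
rewrite subr_eq0; apply: contraNN (Sd _ _ rr') => /eqP H.
have := powR_injective (r := (p.+1%:R : R)^-1).
rewrite invr_gt0 ltr0n => /(_ isT) inj.
by apply/eqP/esym/inj; rewrite ?nnegrE ?sqr_ge0.
Qed.

Lemma regular_well_defined k p (S : 'M[R]_k) :
  regular_spectrum S -> svd_flow_well_defined p.+1 S.
Proof.
move=> [S0 Sd]; apply: well_defined_of_distinct => // r.
by rewrite sqrf_eq0.
Qed.

Lemma near_regular_spectrum k (S : R -> 'M[R]_k) : time_analytic S ->
  (forall r, exists2 t : R, 0 <= t & S t r r != 0) ->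
  (forall r r', r != r' ->
     exists2 t : R, 0 <= t & S t r r ^+ 2 != S t r' r' ^+ 2) ->
  forall t, 0 <= t -> \forall s \near nonneg_dnbhs t, regular_spectrum (S s).
Proof.
move=> Sa S0 Sd t t0.
have Sr r : real_analytic (fun s => S s r r) by exact: time_analytic_entry.
have N1 : \forall s \near nonneg_dnbhs t, forall r, S s r r != 0.
  by apply: filter_forall => r; exact: real_analytic_isolated_zeros.
have N2 : \forall s \near nonneg_dnbhs t, forall rr : 'I_k * 'I_k,
    rr.1 != rr.2 -> S s rr.1 rr.1 ^+ 2 != S s rr.2 rr.2 ^+ 2.
  apply: filter_forall => -[r r'] /=.
  have [->|rr'] := eqVneq r r'; first by near=> s.
  (* Two squares differ exactly when the difference and the sum of the values are nonzero; the
     identity theorem is applied to each of these. *)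
  have [u u0] := Sd _ _ rr'; rewrite -subr_eq0 subr_sqr mulf_eq0 negb_or => /andP[um up].
  have Nm : \forall s \near nonneg_dnbhs t, S s r r - S s r' r' != 0.
    apply: (real_analytic_isolated_zeros (f := fun s => S s r r - S s r' r')) => //.
      by apply: real_analyticD => //; exact: real_analyticN.
    by exists u.
  have Np : \forall s \near nonneg_dnbhs t, S s r r + S s r' r' != 0.
    apply: (real_analytic_isolated_zeros (f := fun s => S s r r + S s r' r')) => //.
      exact: real_analyticD.
    by exists u.
  apply: filterS2 Nm Np => s sm sp _.
  by rewrite -subr_eq0 subr_sqr mulf_neq0.
apply: filterS2 N1 N2 => s s1 s2; split=> // r r' rr'.
exact: (s2 (r, r')).
Unshelve. all: by end_near. Qed.

End Regularity.

(** * Evolution of the left singular vectors with an abstract normal factor *)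

Section LeftVectors.
Context {R : realType} (m n k p q1 q2 : nat).
Variables (G : R -> 'M[R]_(m, n)) (U : R -> 'M[R]_(m, k)) (S : R -> 'M[R]_k)
  (V : R -> 'M[R]_(n, k)) (P : R -> 'M[R]_k)
  (X : R -> 'M[R]_(m, q1)) (Y : R -> 'M[R]_(n, q2)).
Hypotheses (Ua : time_analytic U) (Sa : time_analytic S) (Va : time_analytic V)
  (UU : forall t, 0 <= t -> (U t)^T *m U t = 1%:M)
  (VV : forall t, 0 <= t -> (V t)^T *m V t = 1%:M)
  (Sd : forall t, 0 <= t -> is_diag_mx (S t))
  (XE : forall t, 0 <= t -> (X t *m (X t)^T) ^+ p.+1 =
    U t *m (S t *m S t) *m (U t)^T)
  (YE : forall t, 0 <= t -> (Y t *m (Y t)^T) ^+ p.+1 =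
    V t *m (S t *m S t) *m (V t)^T)
  (dM : forall t, 0 <= t ->
    has_time_derivative (fun s => U s *m S s *m (V s)^T) t
      (- \sum_(j < p.+1) (X t *m (X t)^T) ^+ (p - j) *m G t *m
         (Y t *m (Y t)^T) ^+ j))
  (Gc : forall t, 0 <= t -> G s @[s --> nonneg_dnbhs t] --> G t)
  (Sreg : forall t, 0 <= t ->
    \forall s \near nonneg_dnbhs t, regular_spectrum (S s))
  (Pd : forall t, 0 <= t -> svd_flow_well_defined p.+1 (S t) ->
    is_diag_mx (P t))
  (PS : forall t r, 0 <= t -> svd_flow_well_defined p.+1 (S t) ->
    S t r r != 0 -> P t r r * S t r r = root_spectrum p (S t) 0 r ^+ p)
  (Pc : forall t r, 0 <= t -> svd_flow_well_defined p.+1 (S t) ->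
    S t r r = 0 -> P s r r @[s --> nonneg_dnbhs t] --> P t r r).

Lemma diag_mx_sqr (T : 'M[R]_k) : is_diag_mx T ->
  T *m T = diag_mx (\row_r root_spectrum p T 0 r ^+ p.+1).
Proof.
move=> Td; apply/matrixP => i j.
rewrite mxE (bigD1 i) //= big1 ?addr0; last first.
  by move=> r ri; move/is_diag_mxP: Td => Td; rewrite Td ?mul0r // eq_sym.
rewrite mxE [X in X *+ _]mxE root_spectrumX; case: eqVneq => [<-|ij].
  by rewrite mulr1n expr2.
by rewrite mulr0n; move/is_diag_mxP: Td => /(_ i j) ->; rewrite ?mulr0.
Qed.

(** X stands for W_N and Y for the transpose of W_1, which makes the setting symmetric under
    exchanging left and right. The continuity of dU serves twice: here at vanishing singular values,
    and afterwards at the ill-defined times. *)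
Lemma left_vectors_deriv : exists dU : R -> 'M[R]_(m, k),
  (forall t, 0 <= t ->
    has_time_derivative U t (dU t) /\ dU s @[s --> nonneg_dnbhs t] --> dU t) /\
  (forall t, 0 <= t -> svd_flow_well_defined p.+1 (S t) ->
    dU t = U_flow p.+1 (G t) (U t) (S t) (V t) (P t)).
Proof.
have [dU HU] := time_analytic_deriv Ua; have [dV HV] := time_analytic_deriv Va.
have [dS HS] := time_analytic_deriv Sa.
exists dU; split=> // t t0 wd.
have orth q (Z : R -> 'M[R]_(q, k)) dZ : (forall t, 0 <= t -> (Z t)^T *m Z t = 1%:M) ->
    forall s, 0 <= s -> has_time_derivative Z s (dZ s) ->
    (dZ s)^T *m Z s + (Z s)^T *m dZ s = 0.
  move=> ZZ s s0 Hs; apply: (has_time_derivative_unique s0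
    (has_time_derivative_mulmx (has_time_derivative_trmx Hs) Hs)).
  apply: (eq_has_time_derivative s0 (f := fun=> 1%:M)).
    by move=> u u0; rewrite ZZ.
  exact: has_time_derivative_cst.
have dSd s : 0 <= s -> is_diag_mx (dS s).
  move=> s0; apply/is_diag_mxP => i j ij.
  have [/has_time_derivative_mxP /(_ i j) H _] := HS s s0.
  apply: (time_deriv_unique s0 H).
  have : has_time_derivative (fun=> 0 : 'M[R]_1) s 0 by exact: has_time_derivative_cst.
  move=> /has_time_derivative_mxP /(_ 0 0); rewrite mxE.
  apply: cvg_trans; apply: near_eq_cvg; apply/near_nonneg_dnbhsP; exists 1 => // u u0 _ _.
  by have /is_diag_mxP H1 := Sd u0; have /is_diag_mxP H2 := Sd s0; rewrite H1 // H2 // mxE.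
have AE s : 0 <= s ->
    X s *m (X s)^T = U s *m diag_mx (root_spectrum p (S s)) *m (U s)^T.
  move=> s0; apply: (gram_root (k := p)); [exact: UU|exact: root_spectrum_ge0|].
  by rewrite XE // diag_mx_sqr //; exact: Sd.
have BE s : 0 <= s ->
    Y s *m (Y s)^T = V s *m diag_mx (root_spectrum p (S s)) *m (V s)^T.
  move=> s0; apply: (gram_root (k := p)); [exact: VV|exact: root_spectrum_ge0|].
  by rewrite YE // diag_mx_sqr //; exact: Sd.
have dME s : 0 <= s ->
    dU s *m S s *m (V s)^T + U s *m dS s *m (V s)^T + U s *m S s *m (dV s)^T =
    - \sum_(j < p.+1) (X s *m (X s)^T) ^+ (p - j) *m G s *m (Y s *m (Y s)^T) ^+ j.
  move=> s0; rewrite -mulmxDl; apply: (has_time_derivative_unique s0) (dM s0).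
  apply: has_time_derivative_mulmx; last first.
    by apply: has_time_derivative_trmx; have [] := HV s s0.
  by apply: has_time_derivative_mulmx; [have [] := HU s s0|have [] := HS s s0].
have normal s i r : 0 <= s ->
    ((1%:M - U s *m (U s)^T) *m dU s) i r * S s r r =
    - ((1%:M - U s *m (U s)^T) *m G s *m V s) i r * root_spectrum p (S s) 0 r ^+ p.
  move=> s0.
  exact: (left_normal (UU s0) (VV s0) (Sd s0) (AE s s0) (BE s s0) (dME s s0)).
have normalP s i r : 0 <= s -> svd_flow_well_defined p.+1 (S s) -> S s r r != 0 ->
    ((1%:M - U s *m (U s)^T) *m dU s) i r =
    - ((1%:M - U s *m (U s)^T) *m G s *m V s) i r * P s r r.
  move=> s0 ws Ss; apply: (mulIf Ss); rewrite normal // -(PS s0 ws Ss).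
  by rewrite mulrA.
have [HUt dUc] := HU t t0; have [HVt _] := HV t t0.
apply: (left_flowE (UU t0) (VV t0) (orth _ _ _ UU _ t0 HUt) (orth _ _ _ VV _ t0 HVt)
  (Sd t0) (dSd t t0) (AE t t0) (BE t t0) (root_spectrum_ge0 _ _) (root_spectrumX _ _)
  (dME t t0) (Pd t0 wd)).
- by move=> r; rewrite mxE.
- move=> r s rs; rewrite !mxE -subr_eq0.
  by have [H _] := wd; apply: H; rewrite eq_sym.
(* Where the singular value vanishes at t, the identity holds at nearby times, at which it can be
   divided out, and both sides converge as s tends to t. *)
move=> i r; have [Sr|] := eqVneq (S t r r) 0; last exact: normalP.
have FF := nonneg_dnbhs_proper t0.
have Uc := has_time_derivative_cvg HUt; have Vc := has_time_derivative_cvg HVt.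
have Ec : 1%:M - U s *m (U s)^T @[s --> nonneg_dnbhs t] --> 1%:M - U t *m (U t)^T.
  apply: cvgB; first exact: cvg_cst.
  by apply: cvg_mulmx => //; exact: cvg_trmx.
have /cvg_mxP /(_ i r) Lc : (1%:M - U s *m (U s)^T) *m dU s @[s --> nonneg_dnbhs t]
    --> (1%:M - U t *m (U t)^T) *m dU t by exact: cvg_mulmx.
have /cvg_mxP /(_ i r) Rc : (1%:M - U s *m (U s)^T) *m G s *m V s
    @[s --> nonneg_dnbhs t] --> (1%:M - U t *m (U t)^T) *m G t *m V t.
  by apply: cvg_mulmx => //; apply: cvg_mulmx => //; exact: Gc.
have {}Rc : - ((1%:M - U s *m (U s)^T) *m G s *m V s) i r * P s r r
    @[s --> nonneg_dnbhs t] -->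
    - ((1%:M - U t *m (U t)^T) *m G t *m V t) i r * P t r r.
  by apply: cvgM; [exact: cvgN|exact: Pc].
suff Lc' : ((1%:M - U s *m (U s)^T) *m dU s) i r @[s --> nonneg_dnbhs t] -->
    - ((1%:M - U t *m (U t)^T) *m G t *m V t) i r * P t r r.
  exact: (cvg_unique _ Lc Lc').
apply: cvg_trans Rc; apply: near_eq_cvg.
have /near_nonneg_dnbhsP [d d0 Hd] := Sreg t0; apply/near_nonneg_dnbhsP; exists d => // s s0 sd st.
have rs := Hd s s0 sd st.
by rewrite [RHS]normalP //; [exact: regular_well_defined|have [] := rs].
Qed.

Lemma left_vectors_evolve :
  (forall t, 0 <= t -> svd_flow_well_defined p.+1 (S t) ->
    has_time_derivative U t (U_flow p.+1 (G t) (U t) (S t) (V t) (P t))) /\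
  (forall t, 0 <= t -> exists2 dU, has_time_derivative U t dU &
    U_flow p.+1 (G s) (U s) (S s) (V s) (P s) @[s --> nonneg_dnbhs t] --> dU).
Proof.
have [dU [HU wdU]] := left_vectors_deriv; split=> t t0.
  by move=> /(wdU t t0) <-; have [] := HU t t0.
have [HUt dUc] := HU t t0; exists (dU t) => //.
apply: cvg_trans dUc; apply: near_eq_cvg.
have /near_nonneg_dnbhsP [d d0 Hd] := Sreg t0; apply/near_nonneg_dnbhsP; exists d => // s s0 sd st.
by rewrite wdU //; apply: regular_well_defined; exact: Hd.
Qed.

End LeftVectors.

(** * The two concrete normal factors *)

Section Preconditioners.
Context {R : realType}.

Lemma diag_powR_sqr_entry k (S : 'M[R]_k) q r : is_diag_mx S ->
  diag_powR (S *m S) q r r = (S r r ^+ 2) `^ q.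
Proof.
move=> Sd; rewrite !mxE eqxx mulr1n; congr (_ `^ _).
rewrite (bigD1 r) //= big1 ?addr0 ?expr2 // => s sr.
by move/is_diag_mxP: Sd => /(_ _ _ sr) ->; rewrite mulr0.
Qed.

(** Positivity makes sigma equal to (sigma^2)^(1/2), and 1/2 - 1/N + 1/2 = (N - 1) / N. This is
    where the sign of the singular values counts. *)
Lemma diag_powR_sqrM k p (S : 'M[R]_k) r : is_diag_mx S -> 0 < S r r ->
  diag_powR (S *m S) (2^-1 - p.+1%:R^-1) r r * S r r =
    root_spectrum p S 0 r ^+ p.
Proof.
move=> Sd S0; rewrite diag_powR_sqr_entry // mxE -[RHS]powR_mulrn ?powR_ge0 // -powRrM.
have {2}-> : S r r = (S r r ^+ 2) `^ 2^-1.
  by rewrite powR12_sqrt ?sqr_ge0 // sqrtr_sqr gtr0_norm.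
rewrite -powRD; last by apply/implyP => _; rewrite gt_eqF // exprn_gt0.
congr (_ `^ _).
have p0 : p.+1%:R != 0 :> R by rewrite pnatr_eq0.
by field.
Qed.

(** The exponent q = 0 occurs for N = 2; the power is then constantly 1, also at 0. *)
Lemma powR_cvg_zero (T : Type) (F : set_system T) {FF : Filter F} (f : T -> R) q :
  0 <= q -> (\forall x \near F, 0 <= f x) -> f x @[x --> F] --> (0 : R) ->
  f x `^ q @[x --> F] --> 0 `^ q.
Proof.
rewrite le_eqVlt => /orP[/eqP <- _ _|q0 f0 fc].
  by rewrite powRr0; under eq_fun do rewrite powRr0; exact: cvg_cst.
rewrite powR0 ?gt_eqF //; apply/cvgrPdist_le => e e0.
have d0 : 0 < e `^ q^-1 by exact: powR_gt0.
move/cvgrPdist_le: fc => /(_ _ d0); apply: filterS2 f0 => x fx0.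
rewrite !sub0r !normrN ger0_norm // ger0_norm ?powR_ge0 // => fxd.
have -> : e = (e `^ q^-1) `^ q by rewrite -powRrM mulVf ?gt_eqF // powRr1 // ltW.
by apply: ge0_ler_powR => //; rewrite ?nnegrE ?powR_ge0 // ltW.
Qed.

Lemma invmx_diag k (S : 'M[R]_k) : is_diag_mx S -> (forall r, S r r != 0) ->
  invmx S = diag_mx (\row_r (S r r)^-1).
Proof.
move=> Sd S0; set D := diag_mx _.
have SD : S *m D = 1%:M.
  apply/matrixP => i j; rewrite mul_mx_diag !mxE.
  have [<-|ij] := eqVneq i j; first by rewrite mulfV.
  by move/is_diag_mxP: Sd => ->; rewrite ?mul0r.
have [Su _] := mulmx1_unit SD.
by rewrite -[invmx S]mulmx1 -SD mulmxA mulVmx // mul1mx.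
Qed.

End Preconditioners.

(** The first two conclusions differ in the normal factor: for N = 1, (S^2)^(-1/2) is the inverse of
    |S|, correct for nonnegative singular values, whereas signed ones call for the inverse of S
    itself. *)
Theorem lemma2 (R : realType) (N : nat) (dims : nat -> nat)
    (l : 'M[R]_(dims N, dims 0%N) -> R) (W : R -> layers R dims)
    (U : R -> 'M[R]_(dims N, minn (dims N) (dims 0%N)))
    (S : R -> 'M[R]_(minn (dims N) (dims 0%N)))
    (V : R -> 'M[R]_(dims 0%N, minn (dims N) (dims 0%N)))
    (hN : (1 <= N)%N)
    (hl : mx_analytic l)
    (hflow : gradient_flow l W)
    (hbal : balanced N (W 0))
    (hsvd : analytic_svd (fun t => mxchain (W t) N) U S V)
    (hsign : (1 < N)%N -> forall (t : R) r, 0 <= t -> 0 <= S t r r)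
    (hinit :
      ((forall r, `|S 0 r r| != 0) /\
       (forall r r' : 'I_(minn (dims N) (dims 0%N)), r != r' -> `|S 0 r r| != `|S 0 r' r'|)) \/
      ((forall r, exists2 t : R, 0 <= t & S t r r != 0) /\
       (forall r r' : 'I_(minn (dims N) (dims 0%N)), r != r' ->
          exists2 t : R, 0 <= t & S t r r ^+ 2 != S t r' r' ^+ 2))) :
  [/\ (N = 1%N -> forall (t : R) r, 0 <= t -> 0 <= S t r r) ->
      singular_vectors_evolve N (fun t => mxgrad l (mxchain (W t) N)) U S V
        (fun t => diag_powR (S t *m S t) (2^-1 - N%:R^-1)),
      N = 1%N ->
      singular_vectors_evolve N (fun t => mxgrad l (mxchain (W t) N)) U S V
        (fun t => invmx (S t)),
      forall t : R, 0 <= t ->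
        (forall r, S t r r ^+ 2 != 0) ->
        (forall r r' : 'I_(minn (dims N) (dims 0%N)), r != r' -> S t r r ^+ 2 != S t r' r' ^+ 2) ->
        svd_flow_well_defined N (S t) &
      [set t : R | 0 <= t /\ ~ svd_flow_well_defined N (S t)] `<=`
        isolated [set t : R | 0 <= t /\ ~ svd_flow_well_defined N (S t)]].
Proof.
case: N l U S V hN hl hflow hbal hsvd hsign hinit => // p l U S V _ hl hflow hbal.
move=> [Ua Sa Va Hsvd] hsign hinit.
have UU t : 0 <= t -> (U t)^T *m U t = 1%:M by case/Hsvd.
have VV t : 0 <= t -> (V t)^T *m V t = 1%:M by case/Hsvd.
have Sd t : 0 <= t -> is_diag_mx (S t) by case/Hsvd.
have ME t : 0 <= t -> mxchain (W t) p.+1 = U t *m S t *m (V t)^T by case/Hsvd.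
have trS t : 0 <= t -> (S t)^T = S t.
  by move=> t0; have /diag_mxP [d ->] := Sd t t0; rewrite tr_diag_mx.
have [S0 Sdist] : (forall r, exists2 t : R, 0 <= t & S t r r != 0) /\
    (forall r r', r != r' -> exists2 t : R, 0 <= t & S t r r ^+ 2 != S t r' r' ^+ 2).
  case: hinit => [[S0 Sdist]|//]; split=> [r|r r' rr']; exists 0 => //.
    by rewrite -normr_eq0.
  by apply: contraNN (Sdist _ _ rr') => /eqP H; rewrite -!sqrtr_sqr H.
have Sreg := near_regular_spectrum Sa S0 Sdist.
have bal t (t0 : 0 <= t) := balanced_flow hl hflow hbal t0.
have AE t : 0 <= t -> (W t p *m (W t p)^T) ^+ p.+1 = U t *m (S t *m S t) *m (U t)^T.
  move=> t0; rewrite -mxchain_gramr; last exact: bal.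
  by rewrite ME // !trmx_mul trmxK trS // !mulmxA -(mulmxA _ _^T (V t)) VV // mulmx1.
have BE t : 0 <= t -> ((W t 0%N)^T *m (W t 0%N)^T^T) ^+ p.+1 =
    V t *m (S t *m S t) *m (V t)^T.
  move=> t0; rewrite trmxK -(mxchain_gram (bal t t0)) //.
  by rewrite ME // !trmx_mul trmxK trS // !mulmxA -(mulmxA _ _^T (U t)) UU // mulmx1.
pose G t := mxgrad l (mxchain (W t) p.+1).
have dM t : 0 <= t -> has_time_derivative (fun s => U s *m S s *m (V s)^T) t
    (- \sum_(j < p.+1) (W t p *m (W t p)^T) ^+ (p - j) *m G t *m
      ((W t 0%N)^T *m (W t 0%N)^T^T) ^+ j).
  move=> t0; rewrite trmxK.
  by apply: eq_has_time_derivative (has_time_derivative_flow hl hflow hbal t0).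
have dMT t : 0 <= t -> has_time_derivative (fun s => V s *m S s *m (U s)^T) t
    (- \sum_(j < p.+1) ((W t 0%N)^T *m (W t 0%N)^T^T) ^+ (p - j) *m (G t)^T *m
      (W t p *m (W t p)^T) ^+ j).
  move=> t0; have := has_time_derivative_trmx (dM t t0).
  move/(eq_has_time_derivative t0 (g := fun s => V s *m S s *m (U s)^T)).
  rewrite (_ : (- _)^T = - \sum_(j < p.+1) ((W t 0%N)^T *m (W t 0%N)^T^T) ^+ (p - j) *m
      (G t)^T *m (W t p *m (W t p)^T) ^+ j).
    by apply => s s0; rewrite !trmx_mul trmxK trS // mulmxA.
  rewrite linearN linear_sum /=; congr (- _).
  (* Transposition swaps the powers of A and B, so the sum is reindexed by j -> p - j. *)
  rewrite (reindex_inj rev_ord_inj); apply: eq_bigr => j _ /=.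
  have jp : (j <= p)%N by rewrite -ltnS.
  by rewrite subSS subKn // !trmx_mul !trmx_gram_pow mulmxA.
have Mc t : 0 <= t -> mxchain (W s) p.+1 @[s --> nonneg_dnbhs t] --> mxchain (W t) p.+1.
  move=> t0; exact: has_time_derivative_cvg (has_time_derivative_flow hl hflow hbal t0).
have Gc t : 0 <= t -> G s @[s --> nonneg_dnbhs t] --> G t.
  by move=> t0; apply: continuous_cvg (Mc t t0); exact: mxgrad_continuous.
have GcT t : 0 <= t -> (G s)^T @[s --> nonneg_dnbhs t] --> (G t)^T.
  by move=> t0; apply: cvg_trmx; exact: Gc.
have key (P : R -> 'M[R]_(minn (dims p.+1) (dims 0%N))) :
    (forall t, 0 <= t -> svd_flow_well_defined p.+1 (S t) -> is_diag_mx (P t)) ->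
    (forall t r, 0 <= t -> svd_flow_well_defined p.+1 (S t) -> S t r r != 0 ->
      P t r r * S t r r = root_spectrum p (S t) 0 r ^+ p) ->
    (forall t r, 0 <= t -> svd_flow_well_defined p.+1 (S t) -> S t r r = 0 ->
      P s r r @[s --> nonneg_dnbhs t] --> P t r r) ->
    singular_vectors_evolve p.+1 G U S V P.
  move=> Pd PS Pc.
  have [U1 U2] := left_vectors_evolve Ua Sa Va UU VV Sd AE BE dM Gc Sreg Pd PS Pc.
  have [V1 V2] := left_vectors_evolve Va Sa Ua VV UU Sd BE AE dMT GcT Sreg Pd PS Pc.
  have VE s : U_flow p.+1 (G s)^T (V s) (S s) (U s) (P s) =
      V_flow p.+1 (G s) (U s) (S s) (V s) (P s).
    by rewrite /U_flow /V_flow trmxK [X in hadamard _ X]addrC.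
  split=> [t t0 wd|t t0 _].
    by split; [exact: U1|rewrite -VE; exact: V1].
  have [dU HU cU] := U2 t t0; have [dV HV cV] := V2 t t0.
  exists dU, dV; split=> //.
  by under eq_fun do rewrite -VE.
have wd_near t : 0 <= t ->
    \forall s \near nonneg_dnbhs t, svd_flow_well_defined p.+1 (S s).
  by move=> t0; apply: filterS (Sreg t t0) => s; exact: regular_well_defined.
split.
- move=> hsign1.
  have Sge t r : 0 <= t -> 0 <= S t r r.
    have [p0|p0] := posnP p; first by apply: hsign1; rewrite p0.
    by apply: hsign; rewrite ltnS.
  apply: key => [t t0 _|t r t0 _ Sr|t r t0 wd Sr].
  + exact: diag_mx_is_diag.
  + by apply: diag_powR_sqrM; [exact: Sd|rewrite lt_def Sr Sge].
  (* At a vanishing singular value, well-definedness forces a nonnegative exponent, that is N >=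
     2. *)
  have q0 : 0 <= 2^-1 - p.+1%:R^-1 :> R.
    by have [_ /(_ r)] := wd; rewrite Sr expr0n eqxx => -[].
  rewrite diag_powR_sqr_entry; last exact: Sd.
  rewrite Sr expr0n /=.
  have Sc : S s r r @[s --> nonneg_dnbhs t] --> S t r r.
    have [dS /(_ t t0) [HS _]] := time_analytic_deriv Sa.
    by have /cvg_mxP /(_ r r) := has_time_derivative_cvg HS.
  have S2 : S s r r ^+ 2 @[s --> nonneg_dnbhs t] --> (0 : R).
    rewrite Sr in Sc; rewrite -(mulr0 (0 : R)).
    by under eq_fun do rewrite expr2; exact: cvgM.
  have S2p : \forall s \near nonneg_dnbhs t, 0 <= S s r r ^+ 2.
    by apply: nearW => s; exact: sqr_ge0.
  have E : \forall s \near nonneg_dnbhs t, (S s r r ^+ 2) `^ (2^-1 - p.+1%:R^-1) =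
      diag_powR (S s *m S s) (2^-1 - p.+1%:R^-1) r r.
    apply/near_nonneg_dnbhsP; exists 1 => // s s0 _ _.
    by rewrite diag_powR_sqr_entry //; exact: Sd.
  by apply: cvg_trans (near_eq_cvg E) _; exact: powR_cvg_zero.
- move=> [p0].
  have expr1p (x : R) : x ^+ p = 1 by rewrite p0.
  (* For N = 1 the exponent is -1/2, so well-definedness excludes zero singular values and the
     continuity condition on the factor becomes vacuous. *)
  have nz t r : svd_flow_well_defined p.+1 (S t) -> S t r r != 0.
    case=> _ /(_ r) [h|]; last by rewrite sqrf_eq0.
    by exfalso; move: h; rewrite p0 invr1; lra.
  apply: key => [t t0 wd|t r t0 wd Sr|t r t0 wd Sr].
  + by rewrite invmx_diag ?diag_mx_is_diag ?Sd // => r; exact: nz wd.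
  + rewrite invmx_diag ?Sd //; last by move=> r'; exact: nz wd.
    by rewrite !mxE eqxx mulr1n mulVf ?(nz t r wd)  // expr1p.
  + by have /negP[] := nz t r wd; rewrite Sr.
- move=> t t0 H1 H2; exact: well_defined_of_distinct.
move=> t [t0 nwd]; split; first by rewrite inE.
have /near_nonneg_dnbhsP [d d0 H] := wd_near t t0.
exists [set s | `|s - t| < d].
  apply/nbhs_ballP; exists d => //= s; by rewrite /ball /= distrC.
apply/seteqP; split=> [s [/= sd [s0 nws]]|s -> /=]; last first.
  by rewrite subrr normr0.
by apply/eqP; apply: contrapT => /negP st; apply: nws; exact: H.
Qed.
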